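(* Let $R$ be a prime (respectively, semiprime) left Goldie ring, let $\mathbb S=R[X;\boldsymbol\alpha,\boldsymbol\delta]$ be a skew polynomial ring of bijective type over a well-ordered set of variables, and let $A$ be an essentially special subextension of $\mathbb S$. Then $A$ is left Goldie and $\operatorname{udim}(A)=\operatorname{udim}(R)$. If moreover $A$ is a strongly essentially special subextension of $\mathbb S$, then $A$ is prime (respectively, semiprime).
   Context: Setting (M): $R$ a ring, $\Omega$ an ordinal, $X=\{x_s:s<\Omega\}$; $T_\kappa$ the standard terms $x_{s_1}\cdots x_{s_n}$ ($s_1\le\cdots\le s_n<\kappa$); $\mathbb S$ has subrings $\mathbb S_\kappa$ ($\kappa\le\Omega$) with $\mathbb S_0=R$, $\mathbb S_\Omega=\mathbb S$, $\mathbb S_\kappa$ free as left $R$-module on $T_\kappa$, $\mathbb S_{\kappa+1}=\mathbb S_\kappa[x_\kappa;\alpha_\kappa,\delta_\kappa]$ an Ore extension with $\alpha_\kappa$ an automorphism and $\delta_\kappa$ an $\alpha_\kappa$-derivation, and $\mathbb S_\kappa=\bigcup_{\eta<\kappa}\mathbb S_\eta$ for limit $\kappa$. Univariate notions (for a ring $S\supseteq R$ free as left $R$-module and an Ore extension $S[x;\alpha,\delta]$): $\operatorname{Deg}_x(A)=\{\deg_xf:0\ne f\in A\}$, $d_A=\gcd(\operatorname{Deg}_x(A)\setminus\{0\})$ if $A\not\subseteq S$, else $0$. A subring $A\supseteq R$ is a special subextension if $A=\sum_m(A\cap Sx^m)$, $\operatorname{Deg}_x(A)=d_A\mathbb N$,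 and for each $0\ne m\in\operatorname{Deg}_x(A)$ there exist $\lambda_m=\upsilon_mx^m\in A$ with $\upsilon_m$ regular in $S$, a subring $B_m$ with $R\subseteq B_m\subseteq A\cap S$ and an automorphism $\alpha_{(m)}$ of $B_m$ with $\deg_x(\lambda_mp-\alpha_{(m)}(p)\lambda_m)<m$ for $p\in B_m$, and for every $q\in S$ with $qx^m\in A$ some $u\in B_m$ regular in $S$ with $uqx^m\in B_m\lambda_m$; for $m=0$: $\lambda_0=1$, $B_0=A\cap S$. A subring $A$ of a ring $B$ is nicely essential if for every finite set $E\subseteq B$ of non-zero elements there is $a\in A$ with $0\ne ax\in A$ for all $x\in E$; strongly nicely essential if moreover for every $x\in B$ there is $c\in A$ with $\{a\in A:ac=0\}=0$ and $cx\in A$. (Strongly) essentially special subextension of $\mathbb S$, by induction on $\Omega$: if $\Omega=0$, a (strongly) nicely essential subring of $R$; if $\Omega$ is a limit ordinal, an increasing union $A=\bigcup_{\kappa\in\Lambda}A_\kappa$, $\Lambda\subseteq\Omega$, with each $A_\kappa$ a (strongly) essentially special subextension of $\mathbb S_\kappa$; if $\Omega=\kappa+1$, a (strongly) nicely essential subring of some special subextension $\widetilde A$ of $\mathbb S_\kappa[x_\kappa;\alpha_\kappa,\delta_\kappa]$ such that every attached ring $B_m$ ($m\in\operatorname{Deg}_{x_\kappa}(\widetilde A)$) is a (strongly) essentially special subextension of $\mathbb S_\kappa$. Left Goldie: finite left uniform dimension and ACC on left annihilators. *)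

(* Defs.v *)
(* All rings/subrings are predicates (Prop) on an ambient
   ring S : nzRingType (the skew polynomial ring), so R, S_kappa, A, B_m are
   all subsets of S. *)
From HB Require Import structures.
From Stdlib Require Lists.List.
From mathcomp Require Import all_boot all_order all_algebra.
Set Implicit Arguments.
Unset Strict Implicit.
Unset Printing Implicit Defensive.
Import GRing.Theory.
Local Open Scope ring_scope.

Section Defs.
Variable S : nzRingType.

Definition subset_of (A B : S -> Prop) : Prop := forall a, A a -> B a.

Definition subring (A : S -> Prop) : Prop :=
  [/\ A 1, forall a b, A a -> A b -> A (a - b) & forall a b, A a -> A b -> A (a * b)].

Definition regular_in (T : S -> Prop) (u : S) : Prop :=
  forall s, T s -> (s * u = 0 -> s = 0) /\ (u * s = 0 -> s = 0).

Definition automorphism_on (B : S -> Prop) (phi : S -> S) : Prop :=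
  (forall p, B p -> B (phi p)) /\
  (forall p q, B p -> B q -> phi (p + q) = phi p + phi q) /\
  (forall p q, B p -> B q -> phi (p * q) = phi p * phi q) /\
  phi 1 = 1 /\
  (forall p q, B p -> B q -> phi p = phi q -> p = q) /\
  (forall q, B q -> exists2 p, B p & phi p = q).

Definition derivation_on (B : S -> Prop) (alpha d : S -> S) : Prop :=
  [/\ forall p, B p -> B (d p),
      forall p q, B p -> B q -> d (p + q) = d p + d q &
      forall p q, B p -> B q -> d (p * q) = alpha p * d q + d p * q].

Definition nicely_essential (strong : bool) (A B : S -> Prop) : Prop :=
  [/\ subring A, subset_of A B,
      (forall E : seq S, (forall e, e \in E -> B e /\ e != 0) ->
         exists2 a, A a & forall e, e \in E -> a * e != 0 /\ A (a * e)) &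
      (strong -> forall y, B y ->
         exists2 c, A c & (forall a, A a -> a * c = 0 -> a = 0) /\ A (c * y))].

Definition left_ideal (A L : S -> Prop) : Prop :=
  [/\ subset_of L A, L 0, forall a b, L a -> L b -> L (a + b)
    & forall r a, A r -> L a -> L (r * a)].

Definition indep_nonzero_left_ideals (A : S -> Prop) (n : nat)
    (L : 'I_n -> S -> Prop) : Prop :=
  [/\ forall k, left_ideal A (L k),
      forall k, exists2 l, L k l & l != 0 &
      forall v : 'I_n -> S, (forall k, L k (v k)) ->
        \sum_(k < n) v k = 0 -> forall k, v k = 0].

Definition udim (A : S -> Prop) (n : nat) : Prop :=
  (exists L : 'I_n -> S -> Prop, indep_nonzero_left_ideals A L) /\
  ~ (exists L : 'I_n.+1 -> S -> Prop, indep_nonzero_left_ideals A L).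

Definition left_ann (A X : S -> Prop) : S -> Prop :=
  fun a => A a /\ forall y, X y -> a * y = 0.

Definition acc_left_ann (A : S -> Prop) : Prop :=
  forall X : nat -> S -> Prop, (forall n, subset_of (X n) A) ->
    (forall n, subset_of (left_ann A (X n)) (left_ann A (X n.+1))) ->
    exists N, forall n, (N <= n)%N ->
      forall a, left_ann A (X n) a <-> left_ann A (X N) a.

Definition left_goldie (A : S -> Prop) : Prop :=
  (exists n, udim A n) /\ acc_left_ann A.

Definition prime_ring (A : S -> Prop) : Prop :=
  forall a b, A a -> A b -> (forall r, A r -> a * r * b = 0) -> a = 0 \/ b = 0.

Definition semiprime_ring (A : S -> Prop) : Prop :=
  forall a, A a -> (forall r, A r -> a * r * a = 0) -> a = 0.

Section Univariate.
Variables (S' : S -> Prop) (y : S).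

Definition deg_lt (f : S) (m : nat) : Prop :=
  exists c : nat -> S, (forall k, S' (c k)) /\ f = \sum_(k < m) c k * y ^+ k.

Definition deg_eq (f : S) (n : nat) : Prop :=
  exists c : nat -> S, [/\ forall k, S' (c k), c n != 0 &
                          f = \sum_(k < n.+1) c k * y ^+ k].

Definition Deg (A : S -> Prop) (n : nat) : Prop :=
  exists f, [/\ A f, f != 0 & deg_eq f n].

(* d is the gcd of the set P \ {0} (for the divisibility order on nat);
   the gcd of the empty set is 0 *)
Definition is_gcd_set (P : nat -> Prop) (d : nat) : Prop :=
  (forall n, P n -> n != 0%N -> (d %| n)%N) /\
  (forall e, (forall n, P n -> n != 0%N -> (e %| n)%N) -> (e %| d)%N).

(* A is a special subextension of the Ore extension T = S'[y; alpha, delta],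
   with attached rings B m (m in Deg_y(A)). *)
Definition special_subext (T A : S -> Prop) (B : nat -> S -> Prop) : Prop :=
  subring A /\ subset_of A T /\ subset_of S' T /\
      (* R <= A is required separately (in [ess]) *)
      (forall a, A a -> exists (n : nat) (c : nat -> S),
          (forall k, S' (c k) /\ A (c k * y ^+ k)) /\
          a = \sum_(k < n) c k * y ^+ k) /\
      (exists d, is_gcd_set (Deg A) d /\
                 forall n, Deg A n <-> exists k, n = (d * k)%N) /\
      (forall p, B 0%N p <-> A p /\ S' p) /\
      (forall m, Deg A m -> m != 0%N ->
        exists (ups : S) (alpha_m : S -> S),
        S' ups /\ regular_in S' ups /\ A (ups * y ^+ m) /\
            subring (B m) /\ subset_of (B m) (fun p => A p /\ S' p) /\
            automorphism_on (B m) alpha_m /\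
            (forall p, B m p ->
               deg_lt (ups * y ^+ m * p - alpha_m p * (ups * y ^+ m)) m) /\
            (forall q, S' q -> A (q * y ^+ m) ->
               exists u, [/\ B m u, regular_in S' u &
                 exists2 b, B m b & u * q * y ^+ m = b * (ups * y ^+ m)])).
End Univariate.

Section Skew.
Variables (R : S -> Prop) (I : Type) (lt : I -> I -> Prop) (x : I -> S).

Fixpoint nondecr (t : list I) : Prop :=
  match t with
  | a :: ((b :: _) as t') => (lt a b \/ a = b) /\ nondecr t'
  | _ => True
  end.

Definition monom (t : list I) : S := \prod_(s <- t) x s.

Definition all_in (D : I -> Prop) (t : list I) : Prop :=
  forall s, Stdlib.Lists.List.In s t -> D s.

Definition Sk (D : I -> Prop) (f : S) : Prop :=
  exists (n : nat) (t : 'I_n -> list I) (r : 'I_n -> S),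
    [/\ forall k, all_in D (t k), forall k, nondecr (t k), forall k, R (r k) &
        f = \sum_(k < n) r k * monom (t k)].

Definition seg (i : I) : I -> Prop := fun s => lt s i.

Definition well_order : Prop :=
  [/\ forall a, ~ lt a a,
      forall a b c, lt a b -> lt b c -> lt a c,
      forall a b, [\/ lt a b, a = b | lt b a] &
      well_founded lt].

Definition skew_poly_bijective (alpha delta : I -> S -> S) : Prop :=
  [/\ subring R, well_order,
      (forall (n : nat) (t : 'I_n -> list I) (r : 'I_n -> S),
          (forall j k, t j = t k -> j = k) -> (forall k, nondecr (t k)) ->
          (forall k, R (r k)) -> \sum_(k < n) r k * monom (t k) = 0 ->
          forall k, r k = 0),
      (forall f, Sk (fun _ => True) f) &
      (* S_{i+1} = S_i[x_i; alpha_i, delta_i] *)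
      forall i, [/\ automorphism_on (Sk (seg i)) (alpha i),
                    derivation_on (Sk (seg i)) (alpha i) (delta i) &
                    forall p, Sk (seg i) p ->
                      x i * p = alpha i p * x i + delta i p]].

(* (strongly, if [strong]) essentially special subextensions of S_D,
   D an initial segment of I (an ordinal <= Omega) *)
Inductive ess (strong : bool) : (I -> Prop) -> (S -> Prop) -> Prop :=
  | ess_zero (D : I -> Prop) (A : S -> Prop) :
      (forall s, ~ D s) -> nicely_essential strong A R -> ess strong D A
  | ess_limit (D : I -> Prop) (A : S -> Prop)
      (Lam : I -> Prop) (Af : I -> S -> Prop) :
      (exists s, D s) -> (forall s, D s -> exists2 s', D s' & lt s s') ->
      (forall i, Lam i -> D i) -> (exists i, Lam i) ->
      (forall i j, Lam i -> Lam j -> lt i j -> subset_of (Af i) (Af j)) ->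
      (forall i, Lam i -> ess strong (seg i) (Af i)) ->
      (forall a, A a <-> exists2 i, Lam i & Af i a) ->
      ess strong D A
  | ess_succ (D : I -> Prop) (A : S -> Prop) (i : I)
      (At : S -> Prop) (B : nat -> S -> Prop) :
      D i -> (forall s, D s -> s = i \/ lt s i) ->
      special_subext (Sk (seg i)) (x i) (Sk D) At B -> subset_of R At ->
      subset_of R (B 0%N) ->
      (forall m, Deg (Sk (seg i)) (x i) At m -> m != 0%N -> subset_of R (B m)) ->
      (forall m, Deg (Sk (seg i)) (x i) At m -> ess strong (seg i) (B m)) ->
      nicely_essential strong A At ->
      ess strong D A.

End Skew.
End Defs.

(* Main.v *)
Require Import Defs.
From mathcomp Require Import all_boot all_order all_algebra.
From mathcomp Require Import boolp zify.
Set Implicit Arguments.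
Unset Strict Implicit.
Unset Printing Implicit Defensive.
Import GRing.Theory.
Local Open Scope ring_scope.

(** Let [n] be the left uniform dimension of [R].  Three facts are carried along
    the construction of an essentially special subextension [A]: it contains [n]
    independent elements (multiples of independent elements of [R], which stay
    independent over the whole skew polynomial ring), it contains no [n + 1]
    independent elements, and [n] independent elements of [A] never kill a nonzero
    element of [A] on the left.  All three survive unions of chains and nicely
    essential subrings.  For a special subextension the last two come from
    counting: over [B_0], the part of [A] in degrees below [d J] has uniform
    dimension at most [n J], whereas a nonzero left ideal contributes about [J]
    independent leading terms.  The three facts imply that left annihilators are
    closed, hence ACC on them.

    If [A] is strongly nicely essential in [B], then [a A b = 0] forces
    [a B b = 0]: with [M] the left annihilator of [A b] and [c] left regular such
    that [c r] lies in [A], the left ideal [M c] is essential in [M] and is killed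
    by [r b].  For a special subextension, (semi)primeness is read off leading
    terms [b lambda_m^k], which multiply by the rule
    [b lambda_m^k * b' lambda_m^l = b alpha_(m)^k(b') lambda_m^(k+l)]: thus
    [f A g = 0] gives [b B_m alpha_(m)^k(b') = 0] for [k > 0], and in the semiprime
    case the elements [alpha_(m)^k(b)] would otherwise be infinitely many
    independent elements. *)

(** * Submodules and independent families *)

Lemma exists_neq0 (V : zmodType) (T : Type) (P : T -> Prop) (f : T -> V) :
  ~ (forall a, P a -> f a = 0) -> exists2 a, P a & f a != 0.
Proof. by case/existsNP=> a /not_implyP[Pa /eqP fa0]; exists a. Qed.

Lemma subset_of_leq (S : nzRingType) (L : nat -> S -> Prop) i j :
  (forall k, subset_of (L k) (L k.+1)) -> (i <= j)%N -> subset_of (L i) (L j).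
Proof.
move=> L_incr; apply: (homo_leq (r := @subset_of S)) => // [V a|V U W UV VW a /UV/VW] //.
Qed.

Section Submodules.
Variable S : nzRingType.
Implicit Types (A B U V W : S -> Prop) (s t u : seq S).

Lemma subring1 B : subring B -> B 1.
Proof. by case. Qed.

Lemma subringB B a b : subring B -> B a -> B b -> B (a - b).
Proof. by case=> _ + _; apply. Qed.

Lemma subringM B a b : subring B -> B a -> B b -> B (a * b).
Proof. by case=> _ _; apply. Qed.

Lemma subring0 B : subring B -> B 0.
Proof. by move=> ringB; rewrite -(subrr 1); apply: subringB => //; apply: subring1. Qed.

Lemma subringN B a : subring B -> B a -> B (- a).
Proof. by move=> ringB Ba; rewrite -sub0r; apply: subringB => //; apply: subring0. Qed.

Lemma subringD B a b : subring B -> B a -> B b -> B (a + b).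
Proof.
by move=> ringB Ba Bb; rewrite -[b]opprK; apply: subringB => //; apply: subringN.
Qed.

Lemma subringX B a n : subring B -> B a -> B (a ^+ n).
Proof.
move=> ringB Ba; elim: n => [|n IHn]; first exact: subring1.
by rewrite exprS; apply: subringM.
Qed.

Lemma subringI A B : subring A -> subring B -> subring (fun f => A f /\ B f).
Proof.
move=> ringA ringB; split; first by split; apply: subring1.
  by move=> a b [? ?] [? ?]; split; apply: subringB.
by move=> a b [? ?] [? ?]; split; apply: subringM.
Qed.

Definition submodule B V : Prop :=
  [/\ V 0, forall a b, V a -> V b -> V (a + b) & forall r a, B r -> V a -> V (r * a)].

Lemma submodule_sum B V (J : finType) (P : pred J) (f : J -> S) :
  submodule B V -> (forall j, P j -> V (f j)) -> V (\sum_(j | P j) f j).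
Proof. by case=> V0 VD _ Vf; elim/big_ind: _. Qed.

Lemma submoduleZ B V r a : submodule B V -> B r -> V a -> V (r * a).
Proof. by case=> _ _; apply. Qed.

Lemma submoduleN B V a : subring B -> submodule B V -> V a -> V (- a).
Proof.
move=> ringB modV Va; rewrite -mulN1r; apply: (submoduleZ modV) => //.
by apply: subringN => //; apply: subring1.
Qed.

Lemma submoduleB B V a b : subring B -> submodule B V -> V a -> V b -> V (a - b).
Proof.
move=> ringB modV Va Vb; case: (modV) => _ VD _; apply: VD => //.
exact: submoduleN modV Vb.
Qed.

Lemma subring_submodule B : subring B -> submodule B B.
Proof.
by move=> ringB; split=> [|a b|r a]; [apply: subring0|apply: subringD|apply: subringM].
Qed.

Lemma submodule_sub A B V : subset_of B A -> submodule A V -> submodule B V.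
Proof. by move=> BA [V0 VD VM]; split=> // r a /BA; apply: VM. Qed.

Lemma submoduleI B U V :
  submodule B U -> submodule B V -> submodule B (fun f => U f /\ V f).
Proof.
move=> [U0 UD UM] [V0 VD VM]; split=> // [a b|r a].
  by case=> ? ? [? ?]; split; [apply: UD|apply: VD].
by move=> ringB [? ?]; split; [apply: UM|apply: VM].
Qed.

Definition left_multiples V c (w : S) : Prop := exists2 a, V a & w = a * c.

Lemma left_multiples_submodule B V c : submodule B V -> submodule B (left_multiples V c).
Proof.
move=> [V0 VD VM]; split=> [|_ _ [a Va ->] [b Vb ->]|r _ Br [a Va ->]].
- by exists 0; rewrite ?mul0r.
- by exists (a + b); [apply: VD|rewrite mulrDl].
- by exists (r * a); [apply: VM|rewrite mulrA].
Qed.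

Fixpoint span B s (f : S) : Prop :=
  if s is v :: s' then exists2 b, B b & span B s' (f - b * v) else f = 0.

Lemma span_submodule B s : subring B -> submodule B (span B s).
Proof.
move=> ringB; elim: s => [|v s [s0 sD sM]] /=.
  by split=> // [a b -> ->|r a _ ->]; rewrite ?addr0 ?mulr0.
split=> [|f g [a Ba sa] [b Bb sb]|r f Br [a Ba sa]].
- by exists 0; [apply: subring0|rewrite mul0r subr0].
- exists (a + b); first exact: subringD.
  by rewrite mulrDl opprD addrACA; apply: sD.
- exists (r * a); first exact: subringM.
  by rewrite -mulrA -mulrBr; apply: sM.
Qed.

Lemma span_min B V s : submodule B V -> {in s, forall v, V v} -> subset_of (span B s) V.
Proof.
move=> modV; elim: s => [_ f ->|v s IHs /forall_cons[Vv Vs] f [b Bb sf]].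
  by case: modV.
rewrite -[f](subrK (b * v)); case: (modV) => _ VD _.
by apply: VD; [apply: IHs sf|apply: submoduleZ modV Bb Vv].
Qed.

Lemma span_behead B v s : subring B -> subset_of (span B s) (span B (v :: s)).
Proof.
by move=> ringB f sf; exists 0; [apply: subring0|rewrite mul0r subr0].
Qed.

Lemma span_head B v s b : subring B -> B b -> span B (v :: s) (b * v).
Proof.
by move=> ringB Bb; exists b; rewrite // subrr; have [] := span_submodule s ringB.
Qed.

Lemma mem_span B s : subring B -> {in s, forall v, span B s v}.
Proof.
move=> ringB; elim: s => // v s IHs; apply/forall_cons; split.
  by rewrite -[X in span _ _ X]mul1r; apply: span_head => //; apply: subring1.
by move=> u /IHs; apply: span_behead.
Qed.

Lemma span_subset A B s : subring B -> subset_of A B -> subset_of (span A s) (span B s).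
Proof.
move=> ringB AB; apply: span_min; last exact: mem_span.
exact/(submodule_sub AB)/span_submodule.
Qed.

Lemma span_cat B s t f :
  span B (s ++ t) f -> exists2 g, span B s g & span B t (f - g).
Proof.
elim: s f => [|v s IHs] f /=; first by exists 0; rewrite ?subr0.
case=> b Bb /IHs[g sg tg]; exists (g + b * v); last by rewrite opprD addrA addrAC.
by exists b; rewrite ?addrK.
Qed.

Lemma span_mulr_eq0 B s c f : {in s, forall v, v * c = 0} -> span B s f -> f * c = 0.
Proof.
move=> sc0; apply: (span_min (V := fun g => g * c = 0)) => //.
split=> [|a b ac0 bc0|r a _ ac0]; first by rewrite mul0r.
  by rewrite mulrDl ac0 bc0 addr0.
by rewrite -mulrA ac0 mulr0.
Qed.

Lemma span_indexed (T : eqType) B (idx : seq T) (v : T -> S) f :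
  subring B -> uniq idx ->
  span B (map v idx) f <->
  exists2 a : T -> S, (forall i, B (a i)) & f = \sum_(i <- idx) a i * v i.
Proof.
move=> ringB; elim: idx f => [|j idx IHidx] f /=.
  move=> _; split=> [->|[a _ ->]]; last by rewrite big_nil.
  by exists (fun=> 0) => [_|]; [apply: subring0|rewrite big_nil].
case/andP=> j_idx idxU; split=> [[b Bb /(IHidx _ idxU)[a Ba fE]]|[a Ba ->]].
  exists (fun i => if i == j then b else a i) => [i|]; first by case: ifP.
  rewrite big_cons eqxx -[LHS](subrK (b * v j)) fE addrC; congr (_ + _).
  by apply: eq_big_seq => i i_idx; rewrite ifN //; apply: contraNneq j_idx => <-.
exists (a j); rewrite // big_cons addrAC subrr add0r.
by apply/IHidx => //; exists a.
Qed.

(* This triangular condition is equivalent to the directness of the sum of the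
   [B v] (see [indep_indexed]), but it can be checked one vector at a time. *)
Fixpoint indep B s : Prop :=
  if s is v :: s' then
    [/\ v != 0, indep B s' & forall b, B b -> span B s' (b * v) -> b * v = 0]
  else True.

Lemma indep_neq0 B s : indep B s -> {in s, forall v, v != 0}.
Proof. by elim: s => // v s IHs [v0 /IHs sN0 _]; apply/forall_cons. Qed.

Lemma indep_subset A B s : subring B -> subset_of A B -> indep B s -> indep A s.
Proof.
move=> ringB AB; elim: s => //= v s IHs [v0 /IHs ? vs]; split=> // b Ab sb.
by apply: vs; [apply: AB|apply: span_subset sb].
Qed.

Lemma indep_drop B s k : indep B s -> indep B (drop k s).
Proof. by elim: s k => [|v s IHs] [|k] //= []; auto. Qed.

Lemma indep_cat B s t :
  subring B -> indep B s -> indep B t ->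
  (forall f, span B s f -> span B t f -> f = 0) -> indep B (s ++ t).
Proof.
move=> ringB + ti; elim: s => [//|v s IHs] [v0 si vs] st0.
split=> [//||b Bb /span_cat[g sg tg]].
  by apply: IHs => // f sf; apply: st0; apply: span_behead.
have bv_eq_g : b * v = g.
  apply/eqP; rewrite -subr_eq0; apply/eqP/st0 => //.
  apply: (submoduleB ringB (span_submodule _ ringB)); first exact: span_head.
  exact: span_behead.
by apply: vs; rewrite // bv_eq_g.
Qed.

Lemma indep_indexed (T : eqType) B (idx : seq T) (v : T -> S) :
  subring B -> uniq idx ->
  indep B (map v idx) <->
  {in idx, forall i, v i != 0} /\
  forall a : T -> S, (forall i, B (a i)) -> \sum_(i <- idx) a i * v i = 0 ->
    {in idx, forall i, a i * v i = 0}.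
Proof.
move=> ringB; elim: idx => [|j idx IHidx] //=; case/andP=> j_idx idxU.
split=> [[vj0 /(IHidx idxU)[v0 vi] vj]|[/forall_cons[vj0 v0] vi]].
  split=> [|a Ba]; first exact/forall_cons.
  rewrite big_cons => a0; apply/forall_cons.
  have aj0 : a j * v j = 0.
    apply: vj => //; apply/span_indexed => //.
    exists (fun i => - a i) => [i|]; first exact: subringN.
    by under eq_bigr do rewrite mulNr; rewrite sumrN; apply/eqP; rewrite -addr_eq0 a0.
  by split=> //; apply: vi => //; rewrite aj0 add0r in a0.
split=> // [|b Bb /span_indexed[] // a Ba bE].
  apply/IHidx => //; split=> // a Ba a0 i i_idx.
  pose a' k := if k == j then 0 else a k.
  have a'E k : k \in idx -> a' k = a k.
    by move=> k_idx; rewrite /a' ifN //; apply: contraNneq j_idx => <-.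
  have Ba' k : B (a' k) by rewrite /a'; case: ifP => // _; apply: subring0.
  have /(vi a' Ba')/forall_cons[_ /(_ i i_idx)] : \sum_(k <- j :: idx) a' k * v k = 0.
    rewrite big_cons {1}/a' eqxx mul0r add0r -[RHS]a0.
    by apply: eq_big_seq => k /a'E ->.
  by rewrite a'E.
pose a' k := if k == j then b else - a k.
have Ba' k : B (a' k) by rewrite /a'; case: ifP => // _; apply: subringN.
have /(vi a' Ba')/forall_cons[] : \sum_(k <- j :: idx) a' k * v k = 0.
  rewrite big_cons /a' eqxx bE -big_split /=; apply: big1_seq => k /= k_idx.
  by rewrite ifN ?mulNr ?subrr //; apply: contraNneq j_idx => <-.
by rewrite /a' eqxx.
Qed.

Definition indep_in B V s : Prop := indep B s /\ {in s, forall v, V v}.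

Lemma indep_in_sub B U V s : subset_of U V -> indep_in B U s -> indep_in B V s.
Proof. by move=> UV [? sU]; split=> // v /sU/UV. Qed.

Lemma indep_flatten A B P N s :
  subring A -> subring B -> subset_of B A -> indep A s ->
  {in s, forall v, exists t, size t = N /\
     indep_in B (fun w => P w /\ left_multiples A v w) t} ->
  exists t, size t = (N * size s)%N /\ indep_in B (fun w => P w /\ span A s w) t.
Proof.
move=> ringA ringB BA; elim: s => [|v s IHs] /=.
  by exists [::]; rewrite muln0; do !split.
case=> v0 si vs /forall_cons[[tv [szv [tvi tvP]]] /(IHs si)[t [szt [ti tP]]]].
exists (tv ++ t); rewrite size_cat szv szt mulnS; split=> //; split.
  have mod_Av := submodule_sub BA (left_multiples_submodule v (subring_submodule ringA)).
  apply: indep_cat => // f /(span_min mod_Av)[w /tvP[]//|a Aa ->].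
  move=> /(span_min (submodule_sub BA (span_submodule s ringA))) s_av.
  by apply: vs => //; apply: s_av => w /tP[].
move=> w; rewrite mem_cat => /orP[/tvP[Pw [a Aa wE]]|/tP[? ?]]; split=> //.
  by rewrite wE; apply: span_head.
exact: span_behead.
Qed.

Lemma indep_refine B P s :
  subring B -> indep B s ->
  {in s, forall v, exists b, [/\ B b, b * v != 0 & P (b * v)]} ->
  exists2 t, size t = size s & indep_in B P t.
Proof.
move=> ringB si sP; have [||t [szt t_in]] := @indep_flatten B B P 1 s ringB ringB _ si.
- by [].
- move=> v /sP[b [Bb bv0 Pbv]]; exists [:: b * v]; split=> //; split.
    by split=> // c _ /= ->.
  by move=> w /[!inE] /eqP->; split=> //; exists b.
by exists t; [rewrite szt mul1n|apply: indep_in_sub t_in => w []].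
Qed.

Lemma indep_split B U s :
  subring B -> submodule B U -> indep B s ->
  exists t u, [/\ (size t + size u)%N = size s,
    indep_in B (fun f => span B s f /\ U f) t, indep_in B (span B s) u
    & forall f, span B u f -> U f -> f = 0].
Proof.
move=> ringB modU; elim: s => [_|v s IHs [v0 si vs]].
  by exists [::], [::]; split=> // f ->.
have [t [u [szs [ti ts] [ui us] uU]]] := IHs si.
have s_vs := @span_behead B v s ringB; have span_vs := span_submodule (v :: s) ringB.
have u_s := span_min (span_submodule s ringB) us.
have t_s : subset_of (span B t) (span B s).
  by apply: span_min => [|w /ts[]]; first exact: span_submodule.
case: (pselect (forall f, span B (v :: u) f /\ U f -> f = 0)) => [vuU|].
  exists t, (v :: u); rewrite addnS szs; split=> //; last by move=> f ? ?; apply: vuU.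
  - by split=> // w /ts[/s_vs].
  - split; first by split=> // b Bb /u_s; apply: vs.
    apply/forall_cons; split=> [|w /us/s_vs//]; exact/mem_span/mem_head.
case/(exists_neq0 (f := id)) => f [[b Bb uf] Uf] f0.
exists (f :: t), u; rewrite addSn szs; split=> //; last by split=> // w /us/s_vs.
split; last first.
  apply/forall_cons; split=> [|w /ts[/s_vs]//]; split=> //.
  by exists b => //; apply: u_s.
split=> // c Bc /t_s scf.
have cf_cbv : c * f - c * (b * v) = c * (f - b * v) by rewrite mulrBr.
have span_cbv : span B s (c * b * v).
  rewrite -mulrA -[_ * _](subKr (c * f)) cf_cbv.
  apply: (submoduleB ringB (span_submodule s ringB)) => //.
  by apply: (submoduleZ (span_submodule s ringB)) => //; apply: u_s.
have cbv0 : c * (b * v) = 0 by rewrite mulrA; apply: vs => //; apply: subringM.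
apply: uU; last exact: submoduleZ modU Bc Uf.
by rewrite -[c * f]subr0 -cbv0 cf_cbv; apply: submoduleZ (span_submodule u ringB) _ _.
Qed.

Definition linear_rel B (Phi : S -> S -> Prop) : Prop :=
  [/\ Phi 0 0, forall a a' b b', Phi a b -> Phi a' b' -> Phi (a + a') (b + b')
    & forall r a b, B r -> Phi a b -> Phi (r * a) (r * b)].

Lemma linear_relB B Phi a a' b b' :
  subring B -> linear_rel B Phi -> Phi a b -> Phi a' b' -> Phi (a - a') (b - b').
Proof.
move=> ringB [_ PhiD PhiZ] ab a'b'; rewrite -[a']mul1r -[b']mul1r -!mulNr.
by apply: PhiD => //; apply: PhiZ => //; apply: subringN => //; apply: subring1.
Qed.

Lemma indep_image B W Phi s :
  subring B -> linear_rel B Phi -> (forall w, Phi 0 w -> w = 0) ->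
  indep B s -> (forall f, span B s f -> Phi f 0 -> f = 0) ->
  {in s, forall v, exists2 w, W w & Phi v w} ->
  exists2 t, size t = size s & indep_in B W t.
Proof.
move=> ringB linPhi Phi0 si s_ker sW; have [Phi00 PhiD PhiZ] := linPhi.
suff [t [szt t_in _]] : exists t, [/\ size t = size s, indep_in B W t
    & forall g, span B t g -> exists2 f, span B s f & Phi f g] by exists t.
elim: s si s_ker sW => [_ _ _|v s IHs [v0 si vs] s_ker].
  by exists [::]; split=> // g ->; exists 0.
case/forall_cons=> [[w Ww vw] /(IHs si)[f sf|t [szt [ti tW] t_s]]].
  by apply: s_ker; apply: span_behead.
have span_vs := span_submodule (v :: s) ringB.
exists (w :: t); split; first by rewrite /= szt.
  split; last exact/forall_cons.
  split=> // [|b Bb /t_s[f sf fbw]].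
    apply: contra_neq v0 => w0; apply: s_ker; last by rewrite -w0.
    exact/mem_span/mem_head.
  have bvf0 : b * v - f = 0.
    apply: s_ker.
      by apply: (submoduleB ringB span_vs); [apply: span_head|apply: span_behead].
    rewrite -[X in Phi _ X](subrr (b * w)).
    by apply: (linear_relB ringB linPhi) fbw; apply: PhiZ.
  have bv0 : b * v = 0 by apply: vs => //; rewrite (subr0_eq bvf0).
  by apply: Phi0; rewrite -bv0; apply: PhiZ.
move=> g [b Bb /t_s[f sf fg]]; exists (b * v + f).
  by exists b; rewrite // addrAC subrr add0r.
by rewrite -[g](subrKC (b * w)); apply: PhiD => //; apply: PhiZ.
Qed.

Lemma indep_chain B (w : nat -> S) (L : nat -> S -> Prop) m :
  subring B -> (forall k, submodule B (L k)) -> (forall k, subset_of (L k) (L k.+1)) ->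
  (forall k, L k.+1 (w k)) -> (forall k, w k != 0) ->
  (forall k b, B b -> L k (b * w k) -> b * w k = 0) -> indep B (rev (mkseq w m)).
Proof.
move=> ringB modL Lincr Lw w0 wL; elim: m => [//|m IHm].
rewrite mkseqS rev_rcons; split=> // b Bb s_bw; apply: wL => //.
apply: (span_min (modL m)) s_bw => _ /[!mem_rev] /mapP[k + ->].
by rewrite mem_iota => /andP[_ km]; apply: (subset_of_leq Lincr km).
Qed.

End Submodules.

(** * Uniform dimension and nonsingularity *)

Section UniformDimension.
Variable S : nzRingType.
Implicit Types (A B U V W X : S -> Prop) (s t : seq S).

Definition udim_ge A (n : nat) : Prop := exists2 s, size s = n & indep_in A A s.

Definition udim_le B V (n : nat) : Prop := forall s, indep_in B V s -> (size s <= n)%N.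

(* Left nonsingularity of [V] over a ring [B] of uniform dimension [n]: there, the
   essential left ideals are those containing [n] independent elements. *)
Definition nonsingular (n : nat) B V : Prop :=
  forall s a, indep_in B B s -> (n <= size s)%N -> V a ->
    {in s, forall v, v * a = 0} -> a = 0.

Definition nonsing_udim (n : nat) A : Prop :=
  [/\ subring A, udim_ge A n, udim_le A A n & nonsingular n A A].

Lemma udim_le_subset B V W n : subset_of W V -> udim_le B V n -> udim_le B W n.
Proof. by move=> WV le_n s /(indep_in_sub WV)/le_n. Qed.

Lemma udim_le_extension B V W Phi k l :
  subring B -> submodule B V -> linear_rel B Phi -> (forall w, Phi 0 w -> w = 0) ->
  (forall v, V v -> exists2 w, W w & Phi v w) ->
  udim_le B (fun f => V f /\ Phi f 0) k -> udim_le B W l -> udim_le B V (k + l).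
Proof.
move=> ringB modV linPhi Phi0 VW le_k le_l s [si sV].
have s_V := span_min modV sV.
have mod_ker : submodule B (fun f => Phi f 0).
  case: linPhi => ? PhiD PhiZ; split=> // [a b a0 b0|r a Br a0].
    by rewrite -[0](addr0 0); apply: PhiD.
  by rewrite -[0](mulr0 r); apply: PhiZ.
have [t [u [<- t_in [ui us] u_ker]]] := indep_split ringB mod_ker si.
have [|w] := indep_image (W := W) ringB linPhi Phi0 ui u_ker.
  by move=> v /us/s_V; apply: VW.
move=> szw /le_l; rewrite szw; apply: leq_add; apply: le_k.
by apply: indep_in_sub t_in => f [/s_V].
Qed.

Lemma udim_le_chain B V n (w : nat -> S) (L : nat -> S -> Prop) :
  subring B -> udim_le B V n -> (forall k, V (w k)) ->
  (forall k, submodule B (L k)) -> (forall k, subset_of (L k) (L k.+1)) ->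
  (forall k, L k.+1 (w k)) -> (forall k, w k != 0) ->
  ~ (forall k b, B b -> L k (b * w k) -> b * w k = 0).
Proof.
move=> ringB le_n Vw modL Lincr Lw w0 wL.
have wi : indep_in B V (rev (mkseq w n.+1)).
  split; first exact: indep_chain wL.
  by move=> _ /[!mem_rev] /mapP[k _ ->].
by have := le_n _ wi; rewrite size_rev size_mkseq ltnn.
Qed.

Lemma indep_left_idealsP A n : subring A ->
  (exists L : 'I_n -> S -> Prop, indep_nonzero_left_ideals A L) <-> udim_ge A n.
Proof.
move=> ringA; split=> [[L [Lid L_neq0 Lsum]]|[s szs [si sA]]].
  have /choice[l Ll] k : exists l, L k l /\ l != 0.
    by have [l ? ?] := L_neq0 k; exists l.
  have LA k : subset_of (L k) A by have [] := Lid k.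
  exists (map l (enum 'I_n)); first by rewrite size_map size_enum_ord.
  split; last by move=> _ /mapP[k _ ->]; apply: (LA k); have [] := Ll k.
  apply/(indep_indexed l ringA (enum_uniq 'I_n)); split=> [k _|a Aa].
    by have [] := Ll k.
  rewrite big_enum /= => a0 k _; apply: (Lsum (fun k => a k * l k)) => // j.
  by have [_ _ _] := Lid j; apply=> //; have [] := Ll j.
pose v (k : 'I_n) := s`_k.
have sE : s = map v (enum 'I_n).
  by rewrite (map_comp (nth 0 s) val) val_enum_ord -szs [RHS]mkseq_nth.
have /(indep_indexed v ringA (enum_uniq 'I_n))[v0 vi] : indep A (map v (enum 'I_n)).
  by rewrite -sE.
have Av k : A (v k) by apply/sA/mem_nth; rewrite szs.
exists (fun k => left_multiples A (v k)); split=> [k|k|w wL w0 k].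
- have [? ? ?] := left_multiples_submodule (v k) (subring_submodule ringA).
  by split=> // _ [a Aa ->]; apply: subringM.
- exists (v k); last exact/v0/mem_enum.
  by exists 1; [apply: subring1|rewrite mul1r].
- have /choice[a wE] j : exists a, A a /\ w j = a * v j by have [a] := wL j; exists a.
  rewrite (wE k).2; apply: vi => [j||]; [by have [] := wE j| |exact: mem_enum].
  by rewrite big_enum -[RHS]w0; apply: eq_bigr => j _; rewrite (wE j).2.
Qed.

Lemma udimP A n : subring A -> udim A n <-> udim_ge A n /\ udim_le A A n.
Proof.
move=> ringA; rewrite /udim !indep_left_idealsP //; split=> -[ge_n].
  move=> nge; split=> // s [si sA]; rewrite leqNgt; apply/negP => lt_n.
  apply: nge; exists (drop (size s - n.+1) s); first by rewrite size_drop subKn.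
  by split=> [|v /mem_drop/sA//]; apply: indep_drop.
by move=> le_n; split=> // -[s szs /le_n]; rewrite szs ltnn.
Qed.

Lemma indep_span_essential B n s g :
  udim_le B B n -> indep_in B B s -> (n <= size s)%N -> B g -> g != 0 ->
  exists b, [/\ B b, b * g != 0 & span B s (b * g)].
Proof.
move=> le_n [si sB] n_s Bg g0.
suff [b [Bb s_bg] bg0] : exists2 b, B b /\ span B s (b * g) & b * g != 0 by exists b.
apply: exists_neq0 => bg0; suff /le_n : indep_in B B (g :: s) by rewrite ltnNge n_s.
by split; [split=> // b Bb s_bg; apply: bg0|apply/forall_cons].
Qed.

Lemma nonsingular_ex_faithful n B V q :
  subring B -> udim_ge B n -> nonsingular n B V -> V q -> q != 0 ->
  exists g, [/\ B g, g != 0 & forall b, B b -> b * g * q = 0 -> b * g = 0].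
Proof.
move=> ringB [s szs [si sB]] Vns Vq; apply: contra_neqP => no_g.
have [v v_s|t szt tin] := indep_refine (P := fun w => B w /\ w * q = 0) ringB si.
  have [Bv v0] := (sB _ v_s, indep_neq0 si v_s).
  have [|b [Bb bvq0] bv0] :=
      exists_neq0 (P := fun b => B b /\ b * v * q = 0) (f := *%R^~ v).
    by move=> v_faithful; apply: no_g; exists v; split=> // b Bb bvq0; apply: v_faithful.
  by exists b; split=> //; split=> //; apply: subringM.
apply: (Vns t) => //; first by apply: indep_in_sub tin => w [].
  by rewrite szt szs.
by move=> w w_t; have [_ /(_ w w_t)[]] := tin.
Qed.

Lemma nonsing_udim_gt0 n A : nonsing_udim n A -> (0 < n)%N.
Proof.
case=> ringA _ _ Ans; rewrite lt0n; apply/negP => /eqP n0.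
by have /eqP := oner_neq0 S; apply; apply: (Ans [::]); rewrite ?n0 //; apply: subring1.
Qed.

(** * Goldie rings and nicely essential subrings *)

Lemma left_ann_submodule A X : subring A -> submodule A (left_ann A X).
Proof.
move=> ringA; split=> [|a b [Aa aX] [Ab bX]|r a Ar [Aa aX]].
- by split=> [|y _]; [apply: subring0|rewrite mul0r].
- by split=> [|y Xy]; [apply: subringD|rewrite mulrDl aX // bX // addr0].
- by split=> [|y Xy]; [apply: subringM|rewrite -mulrA aX // mulr0].
Qed.

Lemma left_ann_proper_indep n A X X' :
  nonsing_udim n A -> subset_of X A ->
  ~ subset_of (left_ann A X') (left_ann A X) ->
  exists w, [/\ left_ann A X' w, w != 0
    & forall a, A a -> left_ann A X (a * w) -> a * w = 0].
Proof.
move=> [ringA ge_n _ Ans] XA /existsNP[z /not_implyP[zX' zX]]; have [Az _] := zX'.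
have [y Xy zy0] : exists2 y, X y & z * y != 0.
  by apply: exists_neq0 => zy0; apply: zX.
have Azy : A (z * y) by apply: subringM (XA y Xy).
have [g [Ag g0 gzy]] := nonsingular_ex_faithful ringA ge_n Ans Azy zy0.
exists (g * z); split=> [||a Aa [_ /(_ y Xy)]].
- exact: submoduleZ (left_ann_submodule X' ringA) Ag zX'.
- apply: contra_neq g0 => gz0; rewrite -[g]mul1r gzy ?mul1r ?mulrA ?gz0 ?mul0r //.
  exact: subring1.
- by rewrite mulrA -(mulrA _ z) => /(gzy a Aa) ->; rewrite mul0r.
Qed.

Lemma nonsing_udim_acc n A : nonsing_udim n A -> acc_left_ann A.
Proof.
move=> Ans X XA Xincr; have [ringA _ le_n _] := Ans.
have Xmono i j : (i <= j)%N -> subset_of (left_ann A (X i)) (left_ann A (X j)).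
  exact: (subset_of_leq (L := fun k => left_ann A (X k))).
apply: contrapT => unstable.
have /choice[next nextP] N : exists p : nat * S, [/\ (N <= p.1)%N, left_ann A (X p.1) p.2,
    p.2 != 0 & forall a, A a -> left_ann A (X N) (a * p.2) -> a * p.2 = 0].
  have [m Nm mN] : exists2 m, (N <= m)%N &
      ~ subset_of (left_ann A (X m)) (left_ann A (X N)).
    apply: contrapT => stable; apply: unstable; exists N => m Nm a.
    split; last exact: Xmono.
    by move: a; apply: contrapT => mN; apply: stable; exists m.
  by have [w [? ? ?]] := left_ann_proper_indep Ans (XA N) mN; exists (m, w).
pose N k := iter k (fun N => (next N).1) 0%N.
apply: (udim_le_chain (w := fun k => (next (N k)).2)
  (L := fun k => left_ann A (X (N k))) ringA le_n).
- by move=> k; have [_ []] := nextP (N k).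
- by move=> k; apply: left_ann_submodule.
- by move=> k; apply: Xmono; have [] := nextP (N k).
- by move=> k; have [] := nextP (N k).
- by move=> k; have [] := nextP (N k).
- by move=> k a Aa; have [_ _ _] := nextP (N k); apply.
Qed.

Lemma nonsing_udim_left_goldie n A : nonsing_udim n A -> left_goldie A /\ udim A n.
Proof.
move=> Ans; have [ringA ge_n le_n _] := Ans.
have An : udim A n by apply/(udimP _ ringA).
by split=> //; split; [exists n|apply: nonsing_udim_acc Ans].
Qed.

(* Otherwise [M c] misses some [A m], and the [m c^k] are independent. *)
Lemma submodule_mulr_essential n A M c m :
  subring A -> udim_le A A n -> submodule A M -> subset_of M A ->
  (forall a, M a -> M (a * c)) -> (forall a, A a -> a * c = 0 -> a = 0) ->
  M m -> m != 0 ->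
  exists a, [/\ A a, a * m != 0 & left_multiples M c (a * m)].
Proof.
move=> ringA le_n modM MA Mc c_lreg mM m0.
suff [a [Aa Mc_am] am0] : exists2 a, A a /\ left_multiples M c (a * m) & a * m != 0.
  by exists a.
apply: exists_neq0 => Mc_m0.
have c_linear : linear_rel A (fun v w => w = v * c).
  by split=> [|a a' _ _ -> ->|r a _ _ ->]; rewrite ?mul0r ?mulrDl ?mulrA.
have [s szs [si sM]] : exists2 s, size s = n.+1 & indep_in A M s.
  elim: n.+1 => [|k [s szs [si sM]]]; first by exists [::].
  have [||v /sM Mv|t szt [ti tMc]] :=
      indep_image (W := left_multiples M c) ringA c_linear _ si.
  - by move=> w; rewrite mul0r.
  - by move=> f /(span_min modM sM)/MA Af /esym; apply: c_lreg.
  - by exists (v * c) => //; exists v.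
  exists (m :: t); first by rewrite /= szt szs.
  split; last by apply/forall_cons; split=> // _ /tMc[m' mM' ->]; apply: Mc.
  by split=> // a Aa /(span_min (left_multiples_submodule c modM) tMc) ?; apply: Mc_m0.
by have := le_n s (conj si (fun v vs => MA _ (sM v vs))); rewrite szs ltnn.
Qed.

Lemma span_common_denominator A B s f :
  {in s, forall v, A v} -> subring A -> span B s f ->
  exists2 E : seq S, {in E, forall e, B e /\ e != 0} &
    forall c, {in E, forall e, A (c * e)} -> span A s (c * f).
Proof.
move=> + ringA; elim: s f => [|v s IHs] f.
  by move=> _ ->; exists [::] => // c _ /=; rewrite mulr0.
case/forall_cons=> Av /IHs{}IHs [b Bb /IHs[E EB Ef]].
exists (if b == 0 then E else b :: E); first by case: eqVneq => // b0; apply/forall_cons.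
move=> c cE; exists (c * b); last rewrite -mulrA -mulrBr; last apply: Ef.
  by case: eqVneq cE => [->|_ /forall_cons[]//]; rewrite mulr0 => _; apply: subring0.
by case: eqVneq cE => [_|_ /forall_cons[]//].
Qed.

Lemma nicely_essential_indep strong A B s :
  subring B -> nicely_essential strong A B -> indep_in A A s -> indep B s.
Proof.
move=> ringB [ringA AB Aess _] [si sA].
elim: s si sA => // v s IHs [v0 si vs] /forall_cons[Av sA].
split=> // [|b Bb /(span_common_denominator sA ringA)[E EB Es]]; first exact: IHs.
apply/eqP/negP => /negP bv0.
have b0 : b != 0 by apply: contra_neq bv0 => ->; rewrite mul0r.
have [|c Ac /forall_cons[[cbv0 _] /forall_cons[[_ Acb] cE]]] := Aess [:: b * v, b & E].
  by apply/forall_cons; split; [split=> //; apply: subringM; auto|apply/forall_cons].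
case/eqP: cbv0; rewrite mulrA; apply: vs => //.
by rewrite -mulrA; apply: Es => e /cE[].
Qed.

Lemma nicely_essential_nonsing_udim n strong A B :
  nonsing_udim n B -> udim_ge A n -> nicely_essential strong A B -> nonsing_udim n A.
Proof.
move=> [ringB _ le_n Bns] ge_n AessB; have [ringA AB _ _] := AessB.
have indepB s : indep_in A A s -> indep_in B B s.
  by move=> sA; split; [apply: (nicely_essential_indep ringB AessB)|move=> v /(sA.2)/AB].
split=> // [s /indepB/le_n//|s a /indepB sB n_s /AB]; exact: Bns.
Qed.

Lemma strongly_essential_ann n A B a b :
  nonsing_udim n A -> nonsing_udim n B -> nicely_essential true A B ->
  A a -> A b -> (forall r, A r -> a * r * b = 0) -> forall r, B r -> a * r * b = 0.
Proof.
move=> [ringA [s szs [si sA]] le_n _] [ringB _ _ Bns] AessB Aa Ab aAb0 r rB.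
have [_ AB _ /(_ isT r rB)[c Ac [c_lreg Acr]]] := AessB.
pose M := left_ann A (left_multiples A b).
have modM : submodule A M by apply: left_ann_submodule.
have Mc m : M m -> M (m * c).
  move=> [Am mAb]; split=> [|_ [t At ->]]; first exact: subringM.
  by rewrite -mulrA; apply: mAb; exists (c * t); [apply: subringM|rewrite mulrA].
have Ma : M a by split=> // _ [t At ->]; rewrite mulrA aAb0.
have [v v_s|t szt tA] := indep_refine (P := fun w => A w /\ w * (a * r * b) = 0) ringA si.
  have [Av v0] := (sA _ v_s, indep_neq0 si v_s).
  case: (eqVneq (v * a) 0) => [va0|va0].
    exists 1; rewrite !mul1r !mulrA va0 !mul0r; split=> //; exact: subring1.
  have [d [Ad dva0 [m [_ mAb] dva]]] :=
    submodule_mulr_essential ringA le_n modM (fun _ => @proj1 _ _) Mc c_lreg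
      (submoduleZ modM Av Ma) va0.
  exists d; split=> //.
    by apply: contra_neq dva0; rewrite mulrA => ->; rewrite mul0r.
  split; first exact: subringM.
  have -> : d * v * (a * r * b) = d * (v * a) * r * b by rewrite !mulrA.
  by rewrite dva -!mulrA; apply: mAb; exists (c * r); rewrite ?mulrA.
have {}tA : indep_in A A t /\ {in t, forall w, w * (a * r * b) = 0}.
  by split=> [|w /(tA.2)[]//]; apply: indep_in_sub tA => w [].
apply: (Bns t); [|by rewrite szt szs| |exact: tA.2].
  by split; [apply: (nicely_essential_indep ringB AessB tA.1)|move=> w /(tA.1.2)/AB].
exact: subringM ringB (subringM ringB (AB _ Aa) rB) (AB _ Ab).
Qed.

Lemma strongly_essential_prime n A B :
  nonsing_udim n A -> nonsing_udim n B -> nicely_essential true A B ->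
  prime_ring B -> prime_ring A.
Proof.
move=> Ans Bns AessB Bprime a b Aa Ab aAb0; have [_ AB _ _] := AessB.
by apply: Bprime; [apply: AB|apply: AB|apply: (strongly_essential_ann Ans Bns AessB)].
Qed.

Lemma strongly_essential_semiprime n A B :
  nonsing_udim n A -> nonsing_udim n B -> nicely_essential true A B ->
  semiprime_ring B -> semiprime_ring A.
Proof.
move=> Ans Bns AessB Bsemi a Aa aAa0; have [_ AB _ _] := AessB.
by apply: Bsemi; [apply: AB|apply: (strongly_essential_ann Ans Bns AessB)].
Qed.

Lemma prime_semiprime A : prime_ring A -> semiprime_ring A.
Proof. by move=> Aprime a Aa /(Aprime _ _ Aa Aa)[]. Qed.

Definition singular A (a : S) : Prop :=
  [/\ A a, a != 0 & forall g, A g -> g != 0 ->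
      exists b, [/\ A b, b * g != 0 & b * g * a = 0]].

Lemma singular_larger_ann A a : subring A -> semiprime_ring A -> singular A a ->
  exists a', [/\ singular A a', forall b, b * a = 0 -> b * a' = 0 &
    exists b, [/\ A b, b * a' = 0 & b * a != 0]].
Proof.
move=> ringA Asemi [Aa a0 a_sing].
have [r Ar ara0] : exists2 r, A r & a * r * a != 0.
  by apply: exists_neq0 => ara0; case/eqP: a0; apply: Asemi.
have A_ar : A (a * r) by apply: subringM.
exists (a * r * a); split=> [|b ba0|].
- split=> // [|g Ag g0]; first exact: subringM.
  have [b [Ab bg0 bga0]] := a_sing g Ag g0; exists b; split=> //.
  by rewrite !mulrA bga0 !mul0r.
- by rewrite !mulrA ba0 !mul0r.
have [|b [Ab bar0 bara0]] := a_sing _ A_ar.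
  by apply: contra_neq ara0 => ->; rewrite mul0r.
exists b; split=> //; first by rewrite mulrA.
by apply: contra_neq bar0; rewrite mulrA => ->; rewrite mul0r.
Qed.

Lemma semiprime_nonsingular n A :
  subring A -> semiprime_ring A -> acc_left_ann A -> udim_le A A n ->
  nonsingular n A A.
Proof.
move=> ringA Asemi Aacc le_n s a s_in n_s Aa sa0; apply/eqP/negP => /negP a0.
have a_sing : singular A a.
  split=> // g Ag g0; have [b [Ab bg0 s_bg]] := indep_span_essential le_n s_in n_s Ag g0.
  by exists b; split=> //; apply: span_mulr_eq0 s_bg.
have /choice[f fP] (z : {z | singular A z}) : exists z' : {z | singular A z},
    (forall b, b * sval z = 0 -> b * sval z' = 0) /\
    exists b, [/\ A b, b * sval z' = 0 & b * sval z != 0].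
  have [z' [z'_sing ? ?]] := singular_larger_ann ringA Asemi (svalP z).
  by exists (exist _ z' z'_sing).
pose z k := sval (iter k f (exist _ a a_sing)).
have [k _ ->|k b [Ab bz0]|N stable] := Aacc (fun k y => y = z k).
- by have [] := svalP (iter k f (exist _ a a_sing)).
- by split=> // _ ->; apply: (fP _).1; apply: bz0.
have [b [Ab bz0]] := (fP (iter N f (exist _ a a_sing))).2; case/eqP.
have [|_] := (stable N.+1 (leqnSn _) b).1; first by split=> // _ ->.
exact.
Qed.

End UniformDimension.

(** * Directed unions *)

Section DirectedUnion.
Variables (S : nzRingType) (J : Type) (Lam : J -> Prop) (F : J -> S -> Prop).

Definition directed : Prop :=
  (exists j, Lam j) /\
  forall i j, Lam i -> Lam j ->
    exists k, [/\ Lam k, subset_of (F i) (F k) & subset_of (F j) (F k)].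

Definition family_union (a : S) : Prop := exists2 j, Lam j & F j a.

Hypothesis F_directed : directed.

Lemma directed_seq (s : seq S) :
  {in s, forall a, family_union a} -> exists2 j, Lam j & {in s, forall a, F j a}.
Proof.
elim: s => [_|a s IHs /forall_cons[[i Li Fa] /IHs[j Lj Fs]]].
  by have [j Lj] := F_directed.1; exists j.
have [k [Lk Fi Fj]] := F_directed.2 i j Li Lj.
by exists k => //; apply/forall_cons; split=> [|b /Fs/Fj//]; apply: Fi.
Qed.

Hypothesis F_subring : forall j, Lam j -> subring (F j).

Lemma family_union_subring : subring family_union.
Proof.
split.
- by have [j Lj] := F_directed.1; exists j => //; apply: subring1 (F_subring Lj).
- move=> a b [i Li Fa] [j Lj Fb]; have [k [Lk Fi Fj]] := F_directed.2 i j Li Lj.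
  by exists k => //; apply: subringB; [apply: F_subring|apply: Fi|apply: Fj].
- move=> a b [i Li Fa] [j Lj Fb]; have [k [Lk Fi Fj]] := F_directed.2 i j Li Lj.
  by exists k => //; apply: subringM; [apply: F_subring|apply: Fi|apply: Fj].
Qed.

Lemma span_family_union s f :
  span family_union s f -> exists2 j, Lam j & span (F j) s f.
Proof.
elim: s f => [f f0|v s IHs f [b [i Li Fb] /IHs[j Lj sf]]].
  by have [j Lj] := F_directed.1; exists j.
have [k [Lk Fi Fj]] := F_directed.2 i j Li Lj.
exists k => //; exists b; first exact: Fi.
by apply: span_subset sf => //; apply: F_subring.
Qed.

Lemma indep_family_union s : (forall j, Lam j -> indep (F j) s) -> indep family_union s.
Proof.
elim: s => // v s IHs si; have [j0 Lj0] := F_directed.1.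
split=> [||b [i Li Fb] /span_family_union[j Lj sbv]]; first by case: (si _ Lj0).
  by apply: IHs => j /si[].
have [k [Lk Fi Fj]] := F_directed.2 i j Li Lj; have [_ _ vs] := si k Lk.
by apply: vs; [apply: Fi|apply: span_subset sbv => //; apply: F_subring].
Qed.

End DirectedUnion.

Section DirectedUnionProperties.
Variables (S : nzRingType) (J : Type) (Lam : J -> Prop) (F : J -> S -> Prop).
Hypothesis F_directed : directed Lam F.
Local Notation A := (family_union Lam F).

Lemma family_union_sub j : Lam j -> subset_of (F j) A.
Proof. by move=> Lj a Fa; exists j. Qed.

Lemma family_union_nonsing_udim n :
  (forall j, Lam j -> nonsing_udim n (F j)) -> udim_ge A n -> nonsing_udim n A.
Proof.
move=> Fns ge_n; have ringA : subring A by apply: family_union_subring => // j /Fns[].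
split=> // [s [si sA]|s a [si sA] n_s Aa sa0].
  have [j Lj Fs] := directed_seq F_directed sA; have [_ _ le_n _] := Fns j Lj.
  by apply: le_n; split=> //; apply: indep_subset (family_union_sub Lj) si.
have /(directed_seq F_directed)[j Lj /forall_cons[Fa Fs]] : {in a :: s, forall b, A b}.
  exact/forall_cons.
have [_ _ _ Fjns] := Fns j Lj; apply: Fjns sa0 => //.
by split=> //; apply: indep_subset (family_union_sub Lj) si.
Qed.

Lemma family_union_prime : (forall j, Lam j -> prime_ring (F j)) -> prime_ring A.
Proof.
move=> Fprime a b Aa Ab aAb0.
have /(directed_seq F_directed)[j Lj] : {in [:: a; b], forall c, A c}.
  by do 2![apply/forall_cons; split=> //].
move=> /forall_cons[Fa /forall_cons[Fb _]]; apply: (Fprime j) => // r Fr.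
exact/aAb0/(family_union_sub Lj).
Qed.

Lemma family_union_semiprime :
  (forall j, Lam j -> semiprime_ring (F j)) -> semiprime_ring A.
Proof.
move=> Fsemi a [j Lj Fa] aAa0; apply: (Fsemi j) => // r Fr.
exact/aAa0/(family_union_sub Lj).
Qed.

End DirectedUnionProperties.

(** * Ore extensions *)

Section Automorphisms.
Variables (S : nzRingType) (B : S -> Prop) (phi : S -> S).
Hypothesis B_subring : subring B.
Hypothesis phi_aut : automorphism_on B phi.

Lemma aut_closed p : B p -> B (phi p).
Proof. by case: phi_aut => + _; apply. Qed.

Lemma autD p q : B p -> B q -> phi (p + q) = phi p + phi q.
Proof. by case: phi_aut => _ [+ _]; apply. Qed.

Lemma autM p q : B p -> B q -> phi (p * q) = phi p * phi q.
Proof. by case: phi_aut => _ [_ [+ _]]; apply. Qed.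

Lemma aut1 : phi 1 = 1.
Proof. by case: phi_aut => _ [_ [_ [+ _]]]. Qed.

Lemma aut0 : phi 0 = 0.
Proof.
have B0 := subring0 B_subring; have /eqP := autD B0 B0.
by rewrite addr0 -subr_eq0 opprD addrA subrr add0r oppr_eq0 => /eqP.
Qed.

Lemma aut_inj p q : B p -> B q -> phi p = phi q -> p = q.
Proof. by case: phi_aut => _ [_ [_ [_ [+ _]]]]; apply. Qed.

Lemma aut_eq0 p : B p -> phi p = 0 -> p = 0.
Proof. by move=> Bp; rewrite -[RHS]aut0 => /aut_inj; apply=> //; apply: subring0. Qed.

Lemma aut_surj q : B q -> exists2 p, B p & phi p = q.
Proof. by case: phi_aut => _ [_ [_ [_ [_]]]]; apply. Qed.

Lemma aut_regular u : B u -> regular_in B u -> regular_in B (phi u).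
Proof.
move=> Bu u_reg s /aut_surj[t Bt <-]; have [tu0 ut0] := u_reg t Bt.
rewrite -!autM //; split=> /aut_eq0 prod0.
  by rewrite tu0 ?aut0 //; apply: prod0; apply: subringM.
by rewrite ut0 ?aut0 //; apply: prod0; apply: subringM.
Qed.

End Automorphisms.

Lemma aut_id (S : nzRingType) (B : S -> Prop) : automorphism_on B id.
Proof. by do !split=> //; move=> q; exists q. Qed.

Lemma aut_iter (S : nzRingType) (B : S -> Prop) phi k :
  automorphism_on B phi -> automorphism_on B (iter k phi).
Proof.
move=> phi_aut; elim: k => [|k IHk]; first exact: aut_id.
have iter_closed := aut_closed IHk.
split=> [p Bp|]; first exact/(aut_closed phi_aut)/iter_closed.
split=> [p q Bp Bq|] /=.
  by rewrite (autD IHk) // (autD phi_aut) //; apply: iter_closed.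
split=> [p q Bp Bq|].
  by rewrite (autM IHk) // (autM phi_aut) //; apply: iter_closed.
split; first by rewrite (aut1 IHk) (aut1 phi_aut).
split=> [p q Bp Bq|q Bq].
  move=> /(aut_inj phi_aut (iter_closed _ Bp) (iter_closed _ Bq)).
  exact: (aut_inj IHk).
have [r Br <-] := aut_surj phi_aut Bq; have [p Bp <-] := aut_surj IHk Br.
by exists p.
Qed.

Lemma regular_inM (S : nzRingType) (B : S -> Prop) u v :
  subring B -> B u -> B v -> regular_in B u -> regular_in B v -> regular_in B (u * v).
Proof.
move=> ringB Bu Bv u_reg v_reg s Bs; split.
  by rewrite mulrA => /(v_reg _ (subringM ringB Bs Bu)).1/(u_reg s Bs).1.
by rewrite -mulrA => /(u_reg _ (subringM ringB Bv Bs)).2/(v_reg s Bs).2.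
Qed.

(* The [phi^k b] would form an infinite independent family: the left ideals
   [{f | f B phi^j(b) = 0 for j >= k}] separate them. *)
Lemma semiprime_aut_orthogonal (S : nzRingType) (B : S -> Prop) phi n b :
  subring B -> semiprime_ring B -> udim_le B B n -> automorphism_on B phi -> B b ->
  (forall k r, B r -> b * r * iter k.+1 phi b = 0) -> b = 0.
Proof.
move=> B_subring B_semi le_n phi_aut Bb b_orth; apply/eqP/negP => /negP b0.
have iter_aut k := aut_iter k phi_aut; have B_iter k := aut_closed (iter_aut k) Bb.
pose L k f := B f /\ forall j r, (k <= j)%N -> B r -> f * r * iter j phi b = 0.
apply: (udim_le_chain (w := fun k => iter k phi b) (L := L) B_subring le_n) => // k.
- split; first by split=> [|j r _ _]; [apply: subring0|rewrite !mul0r].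
    move=> f g [Bf Lf] [Bg Lg]; split=> [|j r kj Br]; first exact: subringD.
    by rewrite !mulrDl Lf // Lg // addr0.
  move=> c f Bc [Bf Lf]; split=> [|j r kj Br]; first exact: subringM.
  by rewrite -!mulrA (mulrA f) Lf // mulr0.
- by move=> f [Bf Lf]; split=> // j r /ltnW; apply: Lf.
- split=> // j r kj Br; have [t Bt <-] := aut_surj (iter_aut k) Br.
  have -> : iter j phi b = iter k phi (iter (j - k.+1).+1 phi b).
    by rewrite -iterD; congr (iter _ phi b); lia.
  have Bj := B_iter (j - k.+1).+1.
  rewrite -!(autM (iter_aut k)) ?b_orth ?(aut0 B_subring (iter_aut k)) //.
  exact: subringM.
- by apply: contra_neq b0; apply: (aut_eq0 B_subring (iter_aut k)).
- move=> c Bc [Bcw Lcw]; apply: B_semi => // r Br.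
  by rewrite !mulrA -(mulrA _ r) Lcw //; apply: subringM.
Qed.

Definition ore_extension (S : nzRingType) (K : S -> Prop) (y : S) (alpha delta : S -> S) :
    Prop :=
  [/\ subring K, automorphism_on K alpha, derivation_on K alpha delta,
      forall p, K p -> y * p = alpha p * y + delta p
    & forall m (c : nat -> S), (forall k, K (c k)) ->
        \sum_(k < m) c k * y ^+ k = 0 -> forall k, (k < m)%N -> c k = 0].

Section OreExtension.
Variables (S : nzRingType) (K : S -> Prop) (y : S) (alpha delta : S -> S).
Hypothesis ore : ore_extension K y alpha delta.
Implicit Types (f g c d p : S) (m k : nat).

Definition ore_pol f : Prop := exists m, deg_lt K y f m.

(* [c] may vanish: [f] has degree at most [m]. *)
Definition lead m f c : Prop := K c /\ deg_lt K y (f - c * y ^+ m) m.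

Let K_subring : subring K. Proof. by case: ore. Qed.
Let alpha_aut : automorphism_on K alpha. Proof. by case: ore. Qed.
Let iter_aut m : automorphism_on K (iter m alpha) := aut_iter m alpha_aut.
Let K0 : K 0 := subring0 K_subring.

Lemma deg_lt_submodule m : submodule K (fun f => deg_lt K y f m).
Proof.
split.
- by exists (fun=> 0); split=> //; rewrite big1 // => i _; rewrite mul0r.
- move=> _ _ [c [Kc ->]] [d [Kd ->]]; exists (fun k => c k + d k).
  split=> [k|]; first exact: subringD.
  by rewrite -big_split; apply: eq_bigr => i _; rewrite mulrDl.
- move=> r _ Kr [c [Kc ->]]; exists (fun k => r * c k).
  split=> [k|]; first exact: subringM.
  by rewrite mulr_sumr; apply: eq_bigr => i _; rewrite mulrA.
Qed.

Lemma zero_deg_lt m : deg_lt K y 0 m.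
Proof. by case: (deg_lt_submodule m). Qed.

Lemma deg_lt0 f : deg_lt K y f 0 -> f = 0.
Proof. by case=> c [_ ->]; rewrite big_ord0. Qed.

Lemma deg_lt_term m c k : K c -> (k < m)%N -> deg_lt K y (c * y ^+ k) m.
Proof.
move=> Kc km; exists (fun j => if j == k then c else 0).
split=> [j|]; first by case: ifP.
rewrite (bigD1 (Ordinal km)) //= eqxx big1 ?addr0 // => i.
by rewrite -val_eqE /= => /negPf->; rewrite mul0r.
Qed.

Lemma deg_lt_leq m n f : (m <= n)%N -> deg_lt K y f m -> deg_lt K y f n.
Proof.
move=> mn [c [Kc ->]]; apply: (submodule_sum (deg_lt_submodule n)) => i _.
by apply: deg_lt_term => //; apply: leq_trans mn.
Qed.

Lemma deg_ltD m f g : deg_lt K y f m -> deg_lt K y g m -> deg_lt K y (f + g) m.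
Proof. by case: (deg_lt_submodule m) => _ + _; apply. Qed.

Lemma deg_ltZ m p f : K p -> deg_lt K y f m -> deg_lt K y (p * f) m.
Proof. exact: submoduleZ (deg_lt_submodule m). Qed.

Lemma deg_ltB m f g : deg_lt K y f m -> deg_lt K y g m -> deg_lt K y (f - g) m.
Proof. exact: (submoduleB K_subring (deg_lt_submodule m)). Qed.

Lemma deg_lt_mulXn n m f : deg_lt K y f m -> deg_lt K y (y ^+ n * f) (n + m).
Proof.
have [_ _ [delta_closed _ _] y_mul _] := ore.
move=> deg_f; elim: n => [|n [c [Kc yfE]]]; first by rewrite mul1r.
rewrite exprS -mulrA addSn yfE mulr_sumr.
apply: (submodule_sum (deg_lt_submodule _)) => i _.
rewrite mulrA y_mul // mulrDl -mulrA -exprS; apply: deg_ltD; apply: deg_lt_term.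
- exact: (aut_closed alpha_aut).
- by rewrite ltnS.
- exact: delta_closed.
- exact: leqW.
Qed.

Lemma deg_ltM N m k f g : (m + k <= N.+1)%N ->
  deg_lt K y f m -> deg_lt K y g k -> deg_lt K y (f * g) N.
Proof.
move=> mkN [c [Kc ->]] deg_g; rewrite mulr_suml.
apply: (submodule_sum (deg_lt_submodule N)) => i _; rewrite -mulrA; apply: deg_ltZ => //.
by apply: deg_lt_leq (deg_lt_mulXn i deg_g); move: (ltn_ord i); lia.
Qed.

Lemma const_deg_lt c : K c -> deg_lt K y c 1.
Proof. by move=> Kc; exists (fun=> c); rewrite big_ord1 mulr1. Qed.

Lemma ore_pol_const c : K c -> ore_pol c.
Proof. by exists 1%N; apply: const_deg_lt. Qed.

Lemma ore_polX : ore_pol y.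
Proof.
exists 2%N; rewrite -[X in deg_lt _ _ X]mul1r; apply: (@deg_lt_term 2 1 1) => //.
exact: subring1.
Qed.

Lemma ore_pol_subring : subring ore_pol.
Proof.
split; first by apply: ore_pol_const; apply: subring1.
  move=> f g [m deg_f] [k deg_g]; exists (maxn m k).
  by apply: deg_ltB; [apply: deg_lt_leq deg_f|apply: deg_lt_leq deg_g]; lia.
by move=> f g [m deg_f] [k deg_g]; exists (m + k)%N; apply: deg_ltM deg_f deg_g.
Qed.

Lemma lead_linear m : linear_rel K (lead m).
Proof.
split=> [|f g c d [Kc deg_f] [Kd deg_g]|p f c Kp [Kc deg_f]].
- by split; rewrite // mul0r subr0; apply: zero_deg_lt.
- split; first exact: subringD.
  by rewrite mulrDl opprD addrACA; apply: deg_ltD.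
- split; first exact: subringM.
  by rewrite -mulrA -mulrBr; apply: deg_ltZ.
Qed.

Lemma leadZ m p f c : K p -> lead m f c -> lead m (p * f) (p * c).
Proof. by case: (lead_linear m) => _ _; apply. Qed.

Lemma lead_term m c : K c -> lead m (c * y ^+ m) c.
Proof. by move=> Kc; split; rewrite // subrr; apply: zero_deg_lt. Qed.

Lemma lead_const c : K c -> lead 0 c c.
Proof. by move=> Kc; rewrite -{1}[c]mulr1 -(expr0 y); apply: lead_term. Qed.

Lemma lead0P m f : lead m f 0 <-> deg_lt K y f m.
Proof. by rewrite /lead mul0r subr0; split=> [[]|]. Qed.

Lemma lead_deg_lt m f c : lead m f c -> deg_lt K y f m.+1.
Proof.
move=> [Kc deg_f]; rewrite -[f](subrK (c * y ^+ m)).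
by apply: deg_ltD; [apply: deg_lt_leq deg_f|apply: deg_lt_term].
Qed.

Lemma lead_mulXn m d : K d -> lead m (y ^+ m * d) (iter m alpha d).
Proof.
have [_ _ [delta_closed _ _] y_mul _] := ore.
move=> Kd; elim: m => [|m [Kc IHm]]; first by rewrite mul1r; apply: lead_const.
split; first exact: (aut_closed (iter_aut m.+1)).
rewrite exprS -mulrA -[y ^+ m * d](subrK (iter m alpha d * y ^+ m)) mulrDr.
rewrite [y * (iter m alpha d * _)]mulrA (y_mul _ Kc) iterS.
rewrite mulrDl -!mulrA [X in _ + X - _]addrC addrA addrK.
apply: deg_ltD; first exact: (deg_lt_mulXn 1).
by apply: deg_lt_term => //; apply: delta_closed.
Qed.

Lemma leadM m k f g c d :
  lead m f c -> lead k g d -> lead (m + k) (f * g) (c * iter m alpha d).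
Proof.
move=> lead_f lead_g; have [Kc deg_f] := lead_f; have [Kd deg_g] := lead_g.
have [Kad deg_yd] := lead_mulXn m Kd.
split; first exact: subringM.
have -> : f * g - c * iter m alpha d * y ^+ (m + k) =
  (f - c * y ^+ m) * g + (c * y ^+ m * (g - d * y ^+ k)
     + c * ((y ^+ m * d - iter m alpha d * y ^+ m) * y ^+ k)).
  by rewrite exprD !(mulrBl, mulrBr) !mulrA !addrA !subrK.
apply: deg_ltD; last apply: deg_ltD.
- by apply: deg_ltM deg_f (lead_deg_lt lead_g); lia.
- by apply: deg_ltM (deg_lt_term Kc (ltnSn m)) deg_g; lia.
- apply: deg_ltZ => //; apply: deg_ltM deg_yd _; last first.
    by rewrite -[y ^+ k]mul1r; apply: deg_lt_term (ltnSn k); apply: subring1.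
  by lia.
Qed.

Lemma deg_lt_ex_lead m f : deg_lt K y f m -> f != 0 ->
  exists n c, lead n f c /\ c != 0.
Proof.
case=> c [Kc ->]; elim: m => [|m IHm]; first by rewrite big_ord0 eqxx.
rewrite big_ord_recr /=; case: (eqVneq (c m) 0) => [->|cm0 _].
  by rewrite mul0r addr0.
by exists m, (c m); do 2!split=> //; rewrite addrK; exists c.
Qed.

Lemma lead_deg_eq n f c : lead n f c -> c != 0 -> deg_eq K y f n.
Proof.
move=> [Kc [e [Ke f_low]]] c0.
exists (fun k => if k == n then c else e k); split=> [k||]; first by case: ifP.
  by rewrite eqxx.
rewrite big_ord_recr /= eqxx; apply/eqP; rewrite -subr_eq f_low; apply/eqP.
by apply: eq_bigr => i _; rewrite ltn_eqF.
Qed.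

Lemma lead_inj m f c d : lead m f c -> lead m f d -> c = d.
Proof.
move=> lead_c lead_d; have := linear_relB K_subring (lead_linear m) lead_c lead_d.
have [_ _ _ _ free] := ore; case; rewrite subrr sub0r => Kcd [e [Ke cdE]].
pose e' k := if k == m then c - d else e k.
have : e' m = 0.
  apply: (free m.+1) => // [k|]; first by rewrite /e'; case: ifP.
  rewrite big_ord_recr /e' /= eqxx; apply/eqP; rewrite addr_eq0 cdE; apply/eqP.
  by apply: eq_bigr => i _; rewrite ltn_eqF.
by rewrite /e' eqxx => /subr0_eq.
Qed.

Lemma lead_eq0 m c : lead m 0 c -> c = 0.
Proof. by move/lead_inj; apply; apply/lead0P/zero_deg_lt. Qed.

Lemma lead_lt m n f c : lead m f c -> c != 0 -> deg_lt K y f n -> (m < n)%N.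
Proof.
move=> lead_f c0 deg_f; apply: contra_neqT c0; rewrite -leqNgt => nm.
exact/(lead_inj lead_f)/lead0P/(deg_lt_leq nm).
Qed.

Definition right_pol (U : S -> Prop) m f : Prop :=
  exists2 h : nat -> S, (forall k, U (h k)) & f = \sum_(k < m) y ^+ k * h k.

Lemma right_pol_leq U m n f : U 0 -> (m <= n)%N -> right_pol U m f -> right_pol U n f.
Proof.
move=> U0 mn [h Uh ->]; exists (fun k => if (k < m)%N then h k else 0) => [k|].
  by case: ifP.
rewrite (big_ord_widen n (fun k => y ^+ k * h k) mn) big_mkcond.
by apply: eq_bigr => i _; case: ifP; rewrite ?mulr0.
Qed.

Lemma deg_lt_right_pol m f : deg_lt K y f m -> right_pol K m f.
Proof.
elim: m f => [|m IHm] f; first by move/deg_lt0->; exists (fun=> 0); rewrite ?big_ord0.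
case=> c [Kc fE]; have [p Kp pE] := aut_surj (iter_aut m) (Kc m).
have [_] := lead_mulXn m Kp; rewrite pE => deg_yp.
have [|h Kh hE] := IHm (f - y ^+ m * p).
  by rewrite fE big_ord_recr /= -addrA -opprB; apply: deg_ltB => //; exists c.
exists (fun k => if k == m then p else h k) => [k|]; first by case: ifP.
rewrite big_ord_recr /= eqxx; apply/eqP; rewrite -subr_eq hE; apply/eqP.
by apply: eq_bigr => i _; rewrite ltn_eqF.
Qed.

Lemma right_pol_free m (h : nat -> S) : (forall k, K (h k)) ->
  \sum_(k < m) y ^+ k * h k = 0 -> forall k, (k < m)%N -> h k = 0.
Proof.
move=> Kh; elim: m => [//|m IHm]; rewrite big_ord_recr /= => sum0 k.
have hm0 : h m = 0.
  apply: (aut_eq0 K_subring (iter_aut m)) => //; apply: lead_inj (lead_mulXn m (Kh m)) _.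
  apply/lead0P; move/eqP: sum0; rewrite addrC addr_eq0 => /eqP->.
  apply: (submoduleN K_subring (deg_lt_submodule m)).
  apply: (submodule_sum (deg_lt_submodule m)) => i _.
  by apply: deg_lt_leq (deg_lt_mulXn i (const_deg_lt (Kh i))); rewrite addn1.
rewrite ltnS leq_eqVlt => /predU1P[->//|]; apply: IHm.
by rewrite hm0 mulr0 addr0 in sum0.
Qed.

Lemma span_ore_pol s f : span ore_pol s f -> exists m, right_pol (span K s) m f.
Proof.
elim: s f => [f ->|v s IHs f [b [m /deg_lt_right_pol b_pol] /IHs[n f_pol]]].
  by exists 0%N, (fun=> 0); rewrite ?big_ord0.
have s0 t : span K t 0 by case: (span_submodule t K_subring).
have [p Kp bE] := right_pol_leq K0 (leq_maxl m n) b_pol.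
have [h sh fE] := right_pol_leq (s0 s) (leq_maxr m n) f_pol.
exists (maxn m n), (fun k => h k + p k * v) => [k|].
  by exists (p k); rewrite ?addrK.
rewrite -[f](subrK (b * v)) fE bE mulr_suml -big_split.
by apply: eq_bigr => i _; rewrite mulrDr mulrA.
Qed.

(* Compare the right coefficients of a relation, degree by degree. *)
Lemma indep_ore_pol s : indep_in K K s -> indep ore_pol s.
Proof.
case; elim: s => // v s IHs [v0 si vs] /forall_cons[Kv sK].
split=> // [|b [m /deg_lt_right_pol b_pol] /span_ore_pol[n bv_pol]]; first exact: IHs.
have [s0 _ _] := span_submodule s K_subring.
have [p Kp bE] := right_pol_leq K0 (leq_maxl m n) b_pol.
have [h sh bvE] := right_pol_leq s0 (leq_maxr m n) bv_pol.
rewrite bE mulr_suml; apply: big1 => i _; rewrite -mulrA vs ?mulr0 //.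
suff -> : p i * v = h i by [].
apply/subr0_eq/(@right_pol_free (maxn m n) (fun k => p k * v - h k)) => // [k|].
  apply: subringB => //; first exact: subringM.
  by apply: (span_min (subring_submodule K_subring) sK).
under eq_bigr do rewrite mulrBr mulrA.
by rewrite sumrB -mulr_suml -bE -bvE subrr.
Qed.

End OreExtension.

(** * Special subextensions *)

Section SpecialSubextension.
Variables (S : nzRingType) (K : S -> Prop) (y : S) (alpha delta : S -> S).
Hypothesis ore : ore_extension K y alpha delta.
Variables (T A : S -> Prop) (B : nat -> S -> Prop).
Hypothesis A_special : special_subext K y T A B.

Local Notation lead := (lead K y).
Local Notation deg_lt := (deg_lt K y).

Let K_subring : subring K. Proof. by case: ore. Qed.
Let alpha_aut : automorphism_on K alpha. Proof. by case: ore. Qed.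
Let iter_aut m : automorphism_on K (iter m alpha) := aut_iter m alpha_aut.
Let A_subring : subring A. Proof. by case: A_special. Qed.
Let A_sum a : A a -> exists n (c : nat -> S),
  (forall k, K (c k) /\ A (c k * y ^+ k)) /\ a = \sum_(k < n) c k * y ^+ k.
Proof. by case: A_special => _ [_ [_ [+ _]]]; apply. Qed.
Let B0E p : B 0%N p <-> A p /\ K p.
Proof. by case: A_special => _ [_ [_ [_ [_ [+ _]]]]]; apply. Qed.
Let B0A p : B 0%N p -> A p. Proof. by case/B0E. Qed.
Let B0K p : B 0%N p -> K p. Proof. by case/B0E. Qed.
Let B0_subring : subring (B 0%N).
Proof.
have -> : B 0%N = (fun p => A p /\ K p) by apply/funext => p; apply/propext.
exact: subringI.
Qed.

Definition coef_module (m : nat) (q : S) : Prop := K q /\ A (q * y ^+ m).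

(* The data of a special subextension in degree [m], with [m = 0] included; the
   last clause is [u q y^m = b lambda_m] with [y ^+ m] cancelled. *)
Definition attached (m : nat) (ups : S) (phi : S -> S) : Prop :=
  [/\ coef_module m ups /\ regular_in K ups,
      subring (B m) /\ subset_of (B m) (B 0%N),
      automorphism_on (B m) phi,
      forall p, B m p -> deg_lt (ups * y ^+ m * p - phi p * (ups * y ^+ m)) m
    & forall q, coef_module m q ->
        exists u b, [/\ B m u, regular_in K u, B m b & u * q = b * ups]].

Lemma attached0 : attached 0 1 id.
Proof.
have one_reg : regular_in K 1 by move=> s _; rewrite mulr1 mul1r.
have [K1 A1] := (subring1 K_subring, subring1 A_subring).
split=> //; first by split; rewrite // /coef_module mulr1.
- by split=> // p.
- exact: aut_id.
- by move=> p _; rewrite !mulr1 mul1r subrr; apply: (zero_deg_lt ore).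
- move=> q [Kq /[!mulr1] Aq]; exists 1, q; rewrite mul1r mulr1.
  by split=> //; apply/B0E.
Qed.

Lemma attached_exists m : Deg K y A m -> exists ups phi, attached m ups phi.
Proof.
case: (posnP m) => [-> _|]; first by exists 1, id; apply: attached0.
rewrite lt0n => m0 degm; have [_ [_ [_ [_ [_ [_ data]]]]]] := A_special.
have [ups [phi [Kups [ups_reg [Alam [ringBm [BmB0]]]]]]] := data m degm m0.
case=> phi_aut [comm ess].
have BmK p : B m p -> K p by case/BmB0.
exists ups, phi; split=> //; first by split=> // p /BmB0/B0E.
move=> q [Kq Aq]; have [u [Bu u_reg [b Bb uqb]]] := ess q Kq Aq.
exists u, b; split=> //; apply: (lead_inj ore (m := m) (f := u * q * y ^+ m)).
  by apply: (lead_term ore); apply: subringM => //; apply: BmK.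
by rewrite uqb mulrA; apply: (lead_term ore); apply: subringM => //; apply: BmK.
Qed.

Lemma special_sub_ore_pol : subset_of A (ore_pol K y).
Proof. by move=> a /A_sum[n [c [Kc ->]]]; exists n, c; split=> // k; case: (Kc k). Qed.

Lemma special_lead m f c : A f -> lead m f c -> coef_module m c.
Proof.
move=> /A_sum[n [e [eP ->]]]; have Ke k : K (e k) by case: (eP k).
have zero_coef c' : c' = 0 -> coef_module m c'.
  by move=> ->; split; rewrite ?mul0r; apply: subring0.
elim: n => [|n IHn] lead_c.
  by apply/zero_coef/(lead_eq0 ore (m := m)); rewrite big_ord0 in lead_c.
have lead_e : lead n (\sum_(k < n.+1) e k * y ^+ k) (e n).
  by split; rewrite // big_ord_recr addrK; exists e.
case: (ltngtP n m) => [nm|mn|nm].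
- apply/zero_coef/(lead_inj ore lead_c)/(lead0P ore)/(deg_lt_leq ore nm).
  exact: (lead_deg_lt ore lead_e).
- have en0 : e n = 0.
    apply: (lead_inj ore lead_e); apply/(lead0P ore)/(deg_lt_leq ore mn).
    exact: (lead_deg_lt ore lead_c).
  by apply: IHn; rewrite big_ord_recr /= en0 mul0r addr0 in lead_c.
- by rewrite -nm in lead_c *; rewrite (lead_inj ore lead_c lead_e); have [] := eP n.
Qed.

Variable d : nat.
Hypothesis A_Deg : forall m, Deg K y A m <-> exists k, m = (d * k)%N.

Let attached_mul k : exists ups phi, attached (d * k) ups phi.
Proof. by apply/attached_exists/A_Deg; exists k. Qed.

Lemma special_ex_lead f : A f -> f != 0 -> exists e c, lead (d * e) f c /\ c != 0.
Proof.
move=> Af f0; have [N deg_f] := special_sub_ore_pol Af.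
have [m [c [lead_f c0]]] := deg_lt_ex_lead deg_f f0.
have /A_Deg[e mE] : Deg K y A m by exists f; split=> //; apply: (lead_deg_eq lead_f).
by exists e, c; rewrite -mE.
Qed.

Lemma special_mul_lead k ups f e c : coef_module (d * k) ups -> regular_in K ups ->
  A f -> lead (d * e) f c -> c != 0 ->
  let q := ups * iter (d * k) alpha c in
  [/\ lead (d * (k + e)) (ups * y ^+ (d * k) * f) q, coef_module (d * (k + e)) q
    & q != 0].
Proof.
move=> [Kups Alam] ups_reg Af lead_f c0 /=; have [Kc _] := lead_f.
have Kac := aut_closed (iter_aut (d * k)) Kc.
have lead_lam := leadM ore (lead_term ore (d * k) Kups) lead_f.
rewrite -mulnDr in lead_lam; split=> //.
  exact: special_lead (subringM A_subring Alam Af) lead_lam.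
apply: contra_neq c0 => /(ups_reg _ Kac).2; exact: (aut_eq0 K_subring (iter_aut _) Kc).
Qed.

Variable n : nat.
Hypothesis B_nonsing : forall m, Deg K y A m -> nonsing_udim n (B m).

Let Bmul_nonsing j : nonsing_udim n (B (d * j)).
Proof. by apply/B_nonsing/A_Deg; exists j. Qed.
Let B0_nonsing : nonsing_udim n (B 0%N).
Proof. by have := Bmul_nonsing 0; rewrite muln0. Qed.

(* With [u q = b ups], an essential left ideal killing [q] pulls back along [u]
   to one killing [b]. *)
Lemma coef_module_nonsingular j : nonsingular n (B 0%N) (coef_module (d * j)).
Proof.
move=> s q s_in n_s q_coef sq0; have [_ _ le_n B0ns] := B0_nonsing.
have [ups [phi [[_ ups_reg] [_ BB0] _ _ ess]]] := attached_mul j.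
have [u [b [/BB0 Bu u_reg /BB0 Bb uqb]]] := ess q q_coef; have [Kq _] := q_coef.
suff b0 : b = 0 by apply: (u_reg q Kq).2; rewrite uqb b0 mul0r.
have [si sB] := s_in.
have [v v_s|t szt t_in] :=
    indep_refine (P := fun w => B 0%N w /\ w * b = 0) B0_subring si.
  have [Bv v0] := (sB v v_s, indep_neq0 si v_s).
  have vu0 : v * u != 0 by apply: contra_neq v0; apply: (u_reg v (B0K Bv)).1.
  have Bvu := subringM B0_subring Bv Bu.
  have [c [Bc cvu0 s_cvu]] := indep_span_essential le_n s_in n_s Bvu vu0.
  exists c; split=> //.
    by apply: contra_neq cvu0; rewrite mulrA => ->; rewrite mul0r.
  have Bcv := subringM B0_subring Bc Bv; split=> //.
  apply: (ups_reg _ (B0K (subringM B0_subring Bcv Bb))).1.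
  by rewrite -mulrA -uqb mulrA -(mulrA c); apply: span_mulr_eq0 s_cvu.
apply: (B0ns t); [|by rewrite szt|exact: Bb|by move=> w /(t_in.2)[]].
by apply: indep_in_sub t_in => w [].
Qed.

Lemma coef_module_indep j ups phi s :
  attached (d * j) ups phi -> indep_in (B 0%N) (coef_module (d * j)) s ->
  exists2 t, size t = size s &
    indep_in (B 0%N) (fun b => B (d * j) b /\
      exists u q, [/\ q \in s, B (d * j) u & u * q = b * ups]) t.
Proof.
move=> [[_ ups_reg] [_ BB0] _ _ ess] [si s_coef].
pose W b := B (d * j) b /\ exists u q, [/\ q \in s, B (d * j) u & u * q = b * ups].
have [q q_s|t <- [ti tP]] :=
    indep_refine (P := fun w => exists2 b, W b & w = b * ups) B0_subring si.
  have [u [b [Bu u_reg Bb uqb]]] := ess q (s_coef q q_s); exists u.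
  split; [exact: BB0| |by exists b => //; split=> //; exists u, q].
  by apply: contra_neq (indep_neq0 si q_s); apply: (u_reg q (s_coef q q_s).1).2.
apply: (indep_image (Phi := fun v w => K w /\ v = w * ups)) ti _ _ => //.
- split=> [|v v' w w' [Kw ->] [Kw' ->]|r v w /B0K Kr [Kw ->]].
  + by rewrite mul0r; split=> //; apply: subring0.
  + by rewrite mulrDl; split=> //; apply: subringD.
  + by rewrite mulrA; split=> //; apply: subringM.
- by move=> w [Kw /esym]; apply: (ups_reg w Kw).1.
- by move=> f _ [_ ->]; rewrite mul0r.
- by move=> v /tP[b Wb ->]; exists b => //; split=> //; apply/B0K/BB0; case: Wb.
Qed.

Lemma coef_module_udim_le j : udim_le (B 0%N) (coef_module (d * j)) n.
Proof.
move=> s s_in; have [ups [phi m_attached]] := attached_mul j.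
have [t <- [ti tB]] := coef_module_indep m_attached s_in.
have [_ [_ BB0] _ _ _] := m_attached; have [_ _ le_n _] := Bmul_nonsing j.
apply: le_n; split=> [|b /tB[]//]; exact: indep_subset BB0 ti.
Qed.

(* The multiplier is [g lambda_j], where [b g q = 0] forces [b g = 0] for the
   leading coefficient [q] of [lambda_j f]. *)
Lemma special_faithful_multiple f : A f -> f != 0 -> exists e, forall j, exists a,
  [/\ A a, deg_lt (a * f) (d * (e + j)).+1, a * f != 0
    & forall b, B 0%N b -> deg_lt (b * (a * f)) (d * (e + j)) -> b * (a * f) = 0].
Proof.
move=> Af f0; have [e [c [lead_f c0]]] := special_ex_lead Af f0; exists e => j.
have [ups [_ [[ups_coef ups_reg] _ _ _ _]]] := attached_mul j.
have [] := special_mul_lead ups_coef ups_reg Af lead_f c0.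
set lam := ups * y ^+ _; set q := ups * iter _ _ _ => lead_lamf q_coef q0.
have [ringB0 ge_n _ _] := B0_nonsing.
have [g [Bg g0 g_faithful]] :=
  nonsingular_ex_faithful ringB0 ge_n (@coef_module_nonsingular _) q_coef q0.
have lead_glamf := leadZ ore (B0K Bg) lead_lamf.
exists (g * lam); rewrite -(mulrA g) [(e + j)%N]addnC; split.
- exact: subringM A_subring (B0A Bg) ups_coef.2.
- exact: (lead_deg_lt ore lead_glamf).
- apply: contra_neq g0 => glamf0; rewrite glamf0 in lead_glamf.
  rewrite -[g]mul1r g_faithful ?mul1r //; first exact: subring1.
  exact: (lead_eq0 ore lead_glamf).
- move=> b Bb /(lead0P ore)/(lead_inj ore (leadZ ore (B0K Bb) lead_glamf)).
  by rewrite !(mulrA b g) => /(g_faithful b Bb)->; rewrite mul0r.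
Qed.

Definition lead_coefs (V : S -> Prop) (m : nat) (c : S) : Prop :=
  exists2 f, V f & lead m f c.

Section PositiveDegree.
Hypothesis d_gt0 : (0 < d)%N.

Lemma special_lead_at f j : A f -> deg_lt f (d * j.+1) -> exists c, lead (d * j) f c.
Proof.
move=> Af deg_f; case: (eqVneq f 0) => [->|f0].
  by exists 0; apply/(lead0P ore)/(zero_deg_lt ore).
have [e [c [lead_f c0]]] := special_ex_lead Af f0.
have := lead_lt ore lead_f c0 deg_f; rewrite ltn_mul2l d_gt0 ltnS leq_eqVlt.
case/predU1P=> [<-|ej]; first by exists c.
exists 0; apply/(lead0P ore)/(deg_lt_leq ore _ (lead_deg_lt ore lead_f)).
by rewrite ltn_mul2l d_gt0.
Qed.

Lemma udim_le_filtered V l : submodule A V -> subset_of V A ->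
  (forall j, udim_le (B 0%N) (lead_coefs V (d * j)) l) ->
  forall J, udim_le (B 0%N) (fun f => V f /\ deg_lt f (d * J)) (l * J).
Proof.
move=> modV VA coefs_le; elim=> [|J IHJ].
  case=> // f s [[f0 _ _] /forall_cons[[_ +] _]].
  by rewrite muln0 => /deg_lt0 fE; rewrite fE eqxx in f0.
rewrite [(l * _)%N]mulnS addnC.
apply: (udim_le_extension (Phi := lead (d * J))) (coefs_le J) => //.
- apply: submoduleI; first exact: submodule_sub B0A modV.
  exact: submodule_sub B0K (deg_lt_submodule ore _).
- have [lead00 leadD leadZ] := lead_linear ore (d * J).
  by split=> // r a b /B0K; apply: leadZ.
- by move=> w; apply: (lead_eq0 ore).
- move=> f [Vf deg_f]; have [c lead_f] := special_lead_at (VA f Vf) deg_f.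
  by exists c => //; exists f.
- by apply: udim_le_subset IHJ => f [[Vf _] /(lead0P ore)].
Qed.

Lemma special_indep_multiples f : A f -> f != 0 -> exists e, forall M J, (e <= M)%N ->
  exists t, size t = J /\ indep_in (B 0%N)
    (fun w => deg_lt w (d * (M + J)) /\ left_multiples A f w) t.
Proof.
move=> Af f0; have [e /choice[a aP]] := special_faithful_multiple Af f0.
exists e => M J eM.
exists (rev (mkseq (fun j => a j * f) J)); rewrite size_rev size_mkseq; split=> //; split.
  apply: (indep_chain (L := fun j h => deg_lt h (d * (e + j)))) => // [j|j h|j|j|j].
  - exact: submodule_sub B0K (deg_lt_submodule ore _).
  - by apply: (deg_lt_leq ore); rewrite leq_mul2l addnS leqnSn orbT.
  - have [_ deg_af _ _] := aP j; apply: (deg_lt_leq ore) deg_af.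
    by rewrite ltn_mul2l d_gt0 addnS /=.
  - by have [] := aP j.
  - by have [] := aP j.
move=> _ /[!mem_rev] /mapP[j + ->]; rewrite mem_iota add0n => /andP[_ jJ].
have [Aa deg_af _ _] := aP j; split; last by exists (a j).
by apply: (deg_lt_leq ore) deg_af; rewrite ltn_mul2l d_gt0 -addnS leq_add.
Qed.

(* [m] independent elements of [V] have [m J] multiples independent over [B 0] in
   degrees below [d (M + J)], where at most [l (M + J)] of them fit. *)
Lemma udim_le_special V l : submodule A V -> subset_of V A ->
  (forall j, udim_le (B 0%N) (lead_coefs V (d * j)) l) -> udim_le A V l.
Proof.
move=> modV VA coefs_le s [si sV].
have [M Ms] : exists M, {in s, forall f, forall J, exists t, size t = J /\
    indep_in (B 0%N) (fun w => deg_lt w (d * (M + J)) /\ left_multiples A f w) t}.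
  have /choice[e eP] f : exists e, f \in s -> forall M J, (e <= M)%N ->
      exists t, size t = J /\ indep_in (B 0%N)
        (fun w => deg_lt w (d * (M + J)) /\ left_multiples A f w) t.
    case: (boolP (f \in s)) => [f_s|_]; last by exists 0%N.
    have [e eP] := special_indep_multiples (VA f (sV f f_s)) (indep_neq0 si f_s).
    by exists e.
  exists (\max_(f <- s) e f)%N => f f_s J; apply: eP => //.
  exact: leq_bigmax_seq.
pose J := (l * M).+1.
have [|t [szt t_in]] := @indep_flatten _ A (B 0%N) (fun w => deg_lt w (d * (M + J))) J s
  A_subring B0_subring B0A si.
  by move=> f f_s; apply: Ms.
have : (size t <= l * (M + J))%N.
  apply: (udim_le_filtered modV VA coefs_le); apply: indep_in_sub t_in => w [deg_w s_w].
  by split=> //; apply: span_min s_w.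
by rewrite szt /J; nia.
Qed.

Lemma special_udim_le : udim_le A A n.
Proof.
apply: udim_le_special => // [|j]; first exact: subring_submodule.
by apply: udim_le_subset (@coef_module_udim_le j) => c [f Af /(special_lead Af)].
Qed.

Lemma special_nonsingular : nonsingular n A A.
Proof.
move=> s a s_in n_s Aa sa0; apply/eqP/negP => /negP a0.
have [e [c [lead_a c0]]] := special_ex_lead Aa a0.
pose V := left_ann A (fun z => z = a).
have VA : subset_of V A by move=> f [].
have [j coefs_ge] : exists j, ~ udim_le (B 0%N) (lead_coefs V (d * j)) n.-1.
  apply/existsNP => coefs_le; have n_gt0 := nonsing_udim_gt0 B0_nonsing.
  have : (size s <= n.-1)%N; last by lia.
  apply: (udim_le_special (left_ann_submodule _ A_subring) VA coefs_le).
  by split=> [|v v_s]; [case: s_in|split=> [|_ ->]; [apply: s_in.2|apply: sa0]].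
apply: coefs_ge => t [ti tV]; rewrite leqNgt; apply/negP => n_t.
have [ups [phi m_attached]] := attached_mul j.
have t_in : indep_in (B 0%N) (coef_module (d * j)) t.
  by split=> // q /tV[f [Af _] /(special_lead Af)].
have [w szw [wi wP]] := coef_module_indep m_attached t_in.
have [[ups_coef ups_reg] [_ BB0] _ _ _] := m_attached.
have [_ z_coef z0] := special_mul_lead ups_coef ups_reg Aa lead_a c0.
case/eqP: z0; apply: (coef_module_nonsingular (s := w)) z_coef _.
- by split=> // b /wP[/BB0].
- by rewrite szw; lia.
move=> b /wP[Bb [u [q [q_t Bu uqb]]]].
have [f [_ fa0] lead_f] := tV q q_t.
have := leadM ore lead_f lead_a; rewrite fa0 // => /(lead_eq0 ore) qac0.
by rewrite mulrA -uqb -mulrA qac0 mulr0.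
Qed.

End PositiveDegree.

Lemma special_degree0 : d = 0%N -> A = B 0%N.
Proof.
move=> d0; apply/funext => f; apply/propext; split=> [Af|/B0A//].
apply/B0E; split=> //; case: (eqVneq f 0) => [->|f0]; first exact: subring0.
have [e [c [[Kc]]]] := special_ex_lead Af f0.
by rewrite d0 mul0n mulr1 => /deg_lt0/subr0_eq->.
Qed.

Lemma special_nonsing_udim : udim_ge A n -> nonsing_udim n A.
Proof.
case: (posnP d) => [/special_degree0-> //|d_gt0 ge_n].
by split=> //; [apply: special_udim_le|apply: special_nonsingular].
Qed.

Section LeadAttached.
Variables (m : nat) (ups : S) (phi : S -> S).
Hypothesis m_attached : attached m ups phi.
Local Notation lam := (ups * y ^+ m).

Definition lead_attached k f b : Prop := B m b /\ deg_lt (f - b * lam ^+ k) (k * m).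

Let Kups : K ups. Proof. by case: m_attached => -[[]]. Qed.
Let ups_reg : regular_in K ups. Proof. by case: m_attached => -[]. Qed.
Let Bm_subring : subring (B m). Proof. by case: m_attached => _ []. Qed.
Let phi_aut : automorphism_on (B m) phi. Proof. by case: m_attached. Qed.
Let BmK p : B m p -> K p. Proof. by case: m_attached => _ [_ BB0] _ _ _ /BB0/B0K. Qed.

Lemma lead_pow_lam k : exists c, lead (k * m) (lam ^+ k) c /\ regular_in K c.
Proof.
have K1 := subring1 K_subring; elim: k => [|k [c [lead_lam c_reg]]].
  by exists 1; split; [apply: (lead_const ore)|move=> s _; rewrite mulr1 mul1r].
have [Kc _] := lead_lam; exists (ups * iter m alpha c).
rewrite exprS mulSn; split; first exact: (leadM ore (lead_term ore m Kups) lead_lam).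
apply: regular_inM => //; first exact: (aut_closed (iter_aut m)).
exact: (aut_regular K_subring (iter_aut m)).
Qed.

Lemma deg_lt_pow_lam k : deg_lt (lam ^+ k) (k * m).+1.
Proof. by have [c [/(lead_deg_lt ore)]] := lead_pow_lam k. Qed.

Lemma pow_lam_comm k p : B m p ->
  deg_lt (lam ^+ k * p - iter k phi p * lam ^+ k) (k * m).
Proof.
move=> Bp; have [_ _ _ comm _] := m_attached.
elim: k => [|k IHk]; first by rewrite mul1r mulr1 subrr; apply: (zero_deg_lt ore).
have Bkp : B m (iter k phi p) := aut_closed (aut_iter k phi_aut) Bp.
have -> : lam ^+ k.+1 * p - iter k.+1 phi p * lam ^+ k.+1 =
    lam * (lam ^+ k * p - iter k phi p * lam ^+ k)
    + (lam * iter k phi p - phi (iter k phi p) * lam) * lam ^+ k.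
  by rewrite exprS iterS !(mulrBr, mulrBl) !mulrA addrA subrK.
apply: (deg_ltD ore).
  by apply: (deg_ltM ore _ (deg_lt_term ore Kups (ltnSn m)) IHk); rewrite mulSn addSn.
by apply: (deg_ltM ore _ (comm _ Bkp) (deg_lt_pow_lam k)); rewrite mulSn addnS.
Qed.

Lemma lead_attached_const p : B m p -> lead_attached 0 p p.
Proof. by move=> Bp; split; rewrite // mulr1 subrr; apply: (zero_deg_lt ore). Qed.

Lemma lead_attached_lam k : lead_attached k (lam ^+ k) 1.
Proof. by split; [apply: (subring1 Bm_subring)|rewrite mul1r subrr; apply: (zero_deg_lt ore)]. Qed.

Lemma lead_attachedM k l f g b c : lead_attached k f b -> lead_attached l g c ->
  lead_attached (k + l) (f * g) (b * iter k phi c).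
Proof.
move=> [Bb deg_f] [Bc deg_g]; have Bkc := aut_closed (aut_iter k phi_aut) Bc.
split; first exact: subringM.
have deg_g' : deg_lt g (l * m).+1.
  rewrite -[g](subrK (c * lam ^+ l)); apply: (deg_ltD ore).
    exact: (deg_lt_leq ore _ deg_g).
  exact: (deg_ltZ ore (BmK Bc) (deg_lt_pow_lam l)).
have -> : f * g - b * iter k phi c * lam ^+ (k + l) =
    (f - b * lam ^+ k) * g + b * (lam ^+ k * (g - c * lam ^+ l)
    + (lam ^+ k * c - iter k phi c * lam ^+ k) * lam ^+ l).
  by rewrite exprD !(mulrBr, mulrBl) mulrDr !mulrBr !mulrA !addrA !subrK.
apply: (deg_ltD ore); first by apply: (deg_ltM ore _ deg_f deg_g'); lia.
apply: (deg_ltZ ore (BmK Bb)); apply: (deg_ltD ore).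
  by apply: (deg_ltM ore _ (deg_lt_pow_lam k) deg_g); lia.
by apply: (deg_ltM ore _ (pow_lam_comm k Bc) (deg_lt_pow_lam l)); lia.
Qed.

Lemma lead_attached_eq0 k b : lead_attached k 0 b -> b = 0.
Proof.
move=> [Bb]; rewrite sub0r => deg_b; have [c [lead_lam c_reg]] := lead_pow_lam k.
apply: (c_reg b (BmK Bb)).1; apply: (lead_inj ore (leadZ ore (BmK Bb) lead_lam)).
apply/(lead0P ore); rewrite -[b * _]opprK.
exact: submoduleN K_subring (deg_lt_submodule ore _) deg_b.
Qed.

Lemma lead_attached_ann f g b c :
  lead_attached 1 f b -> lead_attached 1 g c -> (forall r, A r -> f * r * g = 0) ->
  forall k r, B m r -> b * r * iter k.+1 phi c = 0.
Proof.
move=> lead_f lead_g fAg0 k r Br; have [p Bp <-] := aut_surj phi_aut Br.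
have [_ Bc] := (lead_f.1, lead_g.1); have Bkc := aut_closed (aut_iter k phi_aut) Bc.
have lead_plamg := lead_attachedM (lead_attached_const Bp)
  (lead_attachedM (lead_attached_lam k) lead_g).
have := lead_attachedM lead_f lead_plamg; rewrite /= mul1r (autM phi_aut) //.
have [[[_ Alam] _] [_ BB0] _ _ _] := m_attached.
rewrite (mulrA p) (mulrA f) fAg0; last first.
  by apply: subringM => //; [apply/B0A/BB0|apply: subringX].
by move/lead_attached_eq0; rewrite mulrA.
Qed.

End LeadAttached.

Lemma special_ex_lead_attached f e c k ups phi :
  A f -> lead (d * e) f c -> c != 0 -> attached (d * (k + e)) ups phi ->
  exists a b, [/\ A a, b != 0 & lead_attached (d * (k + e)) ups 1 (a * f) b].
Proof.
move=> Af lead_f c0 [_ [_ BB0] _ _ ess].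
have [ups' [_ [[ups'_coef ups'_reg] _ _ _ _]]] := attached_mul k.
have [lead_lamf q_coef q0] := special_mul_lead ups'_coef ups'_reg Af lead_f c0.
have [u [b [Bu u_reg Bb uqb]]] := ess _ q_coef; have [Kq _] := q_coef.
exists (u * (ups' * y ^+ (d * k))), b; split.
- by apply: subringM ups'_coef.2 => //; apply/B0A/BB0.
- by apply: contra_neq q0 => b0; apply: (u_reg _ Kq).2; rewrite uqb b0 mul0r.
- split=> //; rewrite expr1 mul1n (mulrA b) -uqb -(mulrA u).
  by have [_] := leadZ ore (B0K (BB0 u Bu)) lead_lamf.
Qed.

Lemma special_prime : (forall m, Deg K y A m -> prime_ring (B m)) -> prime_ring A.
Proof.
move=> B_prime f g Af Ag fAg0.
case: (eqVneq f 0) => [|f0]; [by left|case: (eqVneq g 0) => [|g0]; [by right|]].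
have [e [c [lead_f c0]]] := special_ex_lead Af f0.
have [e' [c' [lead_g c'0]]] := special_ex_lead Ag g0.
have [ups [phi m_attached]] := attached_mul (e' + e).
have [a [b [Aa b0 lead_af]]] := special_ex_lead_attached Af lead_f c0 m_attached.
have [a' [b' [Aa' b'0 lead_ag]]] : exists a b,
    [/\ A a, b != 0 & lead_attached (d * (e' + e)) ups 1 (a * g) b].
  by move: m_attached; rewrite addnC; apply: special_ex_lead_attached c'0.
have [_ [ringBm _] phi_aut _ _] := m_attached.
have bBb'0 r : B (d * (e' + e)) r -> b * r * phi b' = 0.
  apply: (lead_attached_ann m_attached lead_af lead_ag _ 0) => t At.
  have -> : a * f * t * (a' * g) = a * (f * (t * a') * g) by rewrite !mulrA.
  by rewrite fAg0 ?mulr0 //; apply: subringM.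
have Deg_m : Deg K y A (d * (e' + e)) by apply/A_Deg; exists (e' + e)%N.
have [bE|] := B_prime _ Deg_m b (phi b') lead_af.1 (aut_closed phi_aut lead_ag.1) bBb'0.
  by rewrite bE eqxx in b0.
by move/(aut_eq0 ringBm phi_aut lead_ag.1) => b'E; rewrite b'E eqxx in b'0.
Qed.

Lemma special_semiprime :
  (forall m, Deg K y A m -> semiprime_ring (B m)) -> semiprime_ring A.
Proof.
move=> B_semi f Af fAf0; apply/eqP/negP => /negP f0.
have [e [c [lead_f c0]]] := special_ex_lead Af f0.
have [ups [phi m_attached]] := attached_mul (0 + e).
have [a [b [Aa b0 lead_af]]] := special_ex_lead_attached Af lead_f c0 m_attached.
have [_ [ringBm _] phi_aut _ _] := m_attached; have [_ _ le_n _] := Bmul_nonsing (0 + e).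
have Deg_m : Deg K y A (d * (0 + e)) by apply/A_Deg; exists e.
have B_semi_m := B_semi _ Deg_m.
case/eqP: b0; apply: (semiprime_aut_orthogonal ringBm B_semi_m le_n phi_aut lead_af.1).
apply: (lead_attached_ann m_attached lead_af lead_af) => t At.
have -> : a * f * t * (a * f) = a * (f * (t * a) * f) by rewrite !mulrA.
by rewrite fAf0 ?mulr0 //; apply: subringM.
Qed.

End SpecialSubextension.

(** * Skew polynomial rings *)

Lemma mem_List_In (T : eqType) (a : T) s : a \in s <-> List.In a s.
Proof.
elim: s => //= b s <-; rewrite inE; split=> [/predU1P[]|[->|->]]; rewrite ?eqxx ?orbT; auto.
Qed.

Section SkewPolynomials.
Variables (S : nzRingType) (R : S -> Prop) (I : Type) (lt : I -> I -> Prop).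
Variables (x : I -> S) (alpha delta : I -> S -> S).
Hypothesis skew : skew_poly_bijective R lt x alpha delta.
Implicit Types (i j : I) (D : I -> Prop) (w : seq (seq {classic I})).

Local Notation word := (seq {classic I}).
Local Notation Sk := (Sk R lt x).
Local Notation seg := (seg lt).
Local Notation nondecr := (nondecr lt).
Local Notation monom := (monom x).
Local Notation pol j := (ore_pol (Sk (seg j)) (x j)).

Let R_subring : subring R. Proof. by case: skew. Qed.
Let lt_irr i : ~ lt i i. Proof. by case: skew => _ [+ _ _ _] _ _ _; apply. Qed.
Let lt_trans i j k : lt i j -> lt j k -> lt i k.
Proof. by case: skew => _ [_ + _ _] _ _ _; apply. Qed.
Let lt_total i j : [\/ lt i j, i = j | lt j i].
Proof. by case: skew => _ [_ _ + _] _ _ _; apply. Qed.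
Let lt_wf : well_founded lt. Proof. by case: skew => _ []. Qed.

Lemma increasing_directed (Lam : I -> Prop) (F : I -> S -> Prop) :
  (exists i, Lam i) ->
  (forall i j, Lam i -> Lam j -> lt i j -> subset_of (F i) (F j)) -> directed Lam F.
Proof.
move=> Lam_neq0 F_incr; split=> // i j Li Lj; case: (lt_total i j) => [ij|<-|ji].
- by exists j; split=> //; apply: F_incr.
- by exists i; split=> // a.
- by exists i; split=> //; apply: F_incr.
Qed.

Lemma monom_cat_nseq t n i : monom (t ++ nseq n i) = monom t * x i ^+ n.
Proof. by rewrite /Defs.monom big_cat big_nseq iter_mulr_1. Qed.

Lemma nondecr_cat_nseq t n i :
  nondecr t -> all_in (seg i) t -> nondecr (t ++ nseq n i).
Proof.
elim: t => [_ _|a t IHt] /=; first by elim: n => // -[|n] //= IHn; split=> //; right.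
case: t IHt => [|b t] IHt nd ain.
  by case: n IHt => // n IHt; split; [left; apply: ain; left|apply: IHt => // s []].
by case: nd => ab nd; split=> //; apply: IHt => // s b_t; apply: ain; right.
Qed.

Lemma Sk_term D r t : all_in D t -> nondecr t -> R r -> Sk D (r * monom t).
Proof.
by move=> tD nd Rr; exists 1%N, (fun=> t), (fun=> r); split=> //; rewrite big_ord1.
Qed.

Lemma Sk_min D (V : S -> Prop) : V 0 -> (forall f g, V f -> V g -> V (f + g)) ->
  (forall r t, R r -> nondecr t -> all_in D t -> V (r * monom t)) -> subset_of (Sk D) V.
Proof.
move=> V0 VD Vterm _ [n [t [r [tD nd Rr ->]]]].
by apply: (big_ind V) => // k _; apply: Vterm.
Qed.

Lemma Sk_R D r : R r -> Sk D r.
Proof.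
by move=> Rr; have := @Sk_term D r [::]; rewrite /Defs.monom big_nil mulr1; apply.
Qed.

Lemma SkD D f g : Sk D f -> Sk D g -> Sk D (f + g).
Proof.
move=> [n [t [r [tD nd Rr ->]]]] [n' [t' [r' [tD' nd' Rr' ->]]]].
exists (n + n')%N, (fun k => match split k with inl k => t k | inr k => t' k end),
  (fun k => match split k with inl k => r k | inr k => r' k end).
split=> [k|k|k|]; [by case: split|by case: split|by case: split|].
rewrite big_split_ord; congr (_ + _).
  by apply: eq_bigr => k _; rewrite (unsplitK (inl k)).
by apply: eq_bigr => k _; rewrite (unsplitK (inr k)).
Qed.

Lemma Sk_empty D : (forall s, ~ D s) -> subset_of (Sk D) R.
Proof.
move=> D0; apply: Sk_min => [|f g|r [|s t] Rr _ tD]; first exact: subring0.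
- exact: subringD.
- by rewrite /Defs.monom big_nil mulr1.
- by case: (D0 s); apply: tD; left.
Qed.

(* [w'] is arbitrary so that finitely many elements can be expanded over the same
   words. *)
Lemma Sk_words D f : Sk D f -> exists w,
  {in w, forall t, all_in D t /\ nondecr t} /\
  forall w', uniq w' -> {subset w <= w'} ->
    exists a : word -> S, (forall t, R (a t)) /\ f = \sum_(t <- w') a t * monom t.
Proof.
move=> [n [t [r [tD nd Rr ->]]]]; exists (codom (t : 'I_n -> word)).
split=> [_ /codomP[k ->] //|w' w'_uniq w_w'].
exists (fun u => \sum_(k < n | (t k : word) == u) r k).
split=> [u|]; first exact: (submodule_sum (subring_submodule R_subring)).
under [RHS]eq_bigr do rewrite mulr_suml big_mkcond /=.
rewrite exchange_big; apply: eq_bigr => k _ /=.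
rewrite (bigD1_seq (t k : word)) ?w_w' ?codom_f //= eqxx big1 ?addr0 // => u.
by rewrite eq_sym => /negPf->.
Qed.

Lemma monom_free w (a : word -> S) :
  uniq w -> {in w, forall t, nondecr t} -> (forall t, R (a t)) ->
  \sum_(t <- w) a t * monom t = 0 -> {in w, forall t, a t = 0}.
Proof.
move=> w_uniq nd Ra; rewrite (big_nth [::]) big_mkord => sum0 t /(nthP [::])[k kw <-].
have [_ _ free _ _] := skew.
pose word_of (j : 'I_(size w)) := nth [::] w j.
have word_of_inj : injective word_of.
  by move=> j l /eqP; rewrite nth_uniq // => /eqP/val_inj.
apply: (free _ word_of (a \o word_of) word_of_inj _ _ sum0 (Ordinal kw)) => j //=.
exact/nd/mem_nth.
Qed.

Lemma word_cat_nseqK (i : {classic I}) (t : word) n : all_in (seg i) t ->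
  count_mem i (t ++ nseq n i) = n /\ filter (predC1 i) (t ++ nseq n i) = t.
Proof.
move=> t_i; have {}t_i : {in t, forall s, s != i}.
  by move=> s /mem_List_In/t_i si; apply/eqP => s_i; case: (@lt_irr i); rewrite -{1}s_i.
rewrite count_cat count_nseq /= eqxx mul1n filter_cat filter_nseq /= eqxx cats0.
split; last exact/all_filterP/allP.
rewrite (_ : count_mem _ t = 0%N) //; apply/count_memPn/negP => /t_i.
by rewrite eqxx.
Qed.

Lemma Sk_free i m (c : nat -> S) : (forall n, Sk (seg i) (c n)) ->
  \sum_(n < m) c n * x i ^+ n = 0 -> forall n, (n < m)%N -> c n = 0.
Proof.
move=> Sc sum0; have /choice[w wP] n := Sk_words (Sc n).
pose w0 := undup (flatten [seq w n | n <- index_iota 0 m]).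
have w0P : {in w0, forall t, all_in (seg i) t /\ nondecr t}.
  by move=> t; rewrite mem_undup => /flatten_mapP[n _]; apply: (wP n).1.
have /choice[a aP] n : exists a : word -> S, (forall t, R (a t)) /\
    ((n < m)%N -> c n = \sum_(t <- w0) a t * monom t).
  case: (ltnP n m) => [nm|_]; last by exists (fun=> 0); split=> // _; apply: subring0.
  have [||a [Ra cE]] := (wP n).2 w0; [exact: undup_uniq| |by exists a].
  move=> t t_w; rewrite mem_undup; apply/flatten_mapP.
  by exists n; rewrite // mem_index_iota.
pose coef u := a (count_mem (i : {classic I}) u) (filter (predC1 (i : {classic I})) u).
pose ext n (t : word) : word := t ++ nseq n i.
have coefE n t : t \in w0 -> coef (ext n t) = a n t.
  by case/w0P => /(word_cat_nseqK n)[countE filterE] _; rewrite /coef countE filterE.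
have coef0 : {in [seq ext n t | n <- index_iota 0 m, t <- w0], forall u, coef u = 0}.
  apply: monom_free => [||u|].
  - apply: allpairs_uniq; [exact: iota_uniq|exact: undup_uniq|].
    move=> _ _ /allpairsP[[n t] /= [_ /w0P[t_i _] ->]]
      /allpairsP[[n' t'] /= [_ /w0P[t'_i _] ->]].
    have [countE filterE] := word_cat_nseqK n t_i.
    have [countE' filterE'] := word_cat_nseqK n' t'_i.
    by rewrite /= /ext => e; move: countE filterE; rewrite e countE' filterE' => -> ->.
  - by move=> _ /allpairsP[[n t] /= [_ /w0P[t_i nd] ->]]; apply: nondecr_cat_nseq.
  - exact: (aP _).1.
  rewrite big_allpairs_dep -[RHS]sum0 big_mkord; apply: eq_bigr => n _.
  rewrite (aP n).2 // mulr_suml; apply: eq_big_seq => t t_w0.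
  by rewrite coefE // monom_cat_nseq mulrA.
move=> n nm; rewrite (aP n).2 //; apply: big1_seq => t /= t_w0.
by rewrite -(coefE n t t_w0) coef0 ?mul0r //; apply: allpairs_f; rewrite ?mem_index_iota.
Qed.

Lemma Sk_ore_extension i : subring (Sk (seg i)) ->
  ore_extension (Sk (seg i)) (x i) (alpha i) (delta i).
Proof.
move=> Si; have [_ _ _ _ /(_ i)[alpha_aut delta_der x_mul]] := skew.
by split=> //; apply: Sk_free.
Qed.

Lemma pol_Sk D j : D j -> (forall s, lt s j -> D s) -> subset_of (pol j) (Sk D).
Proof.
move=> Dj D_down _ [m [c [Sc ->]]]; apply: (big_ind (Sk D)) => [||n _].
- by apply: Sk_R; apply: subring0.
- exact: SkD.
apply: (Sk_min (V := fun f => Sk D (f * _))) (Sc n) => [|f g|r t Rr nd tj].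
- by rewrite mul0r; apply: Sk_R; apply: subring0.
- by rewrite mulrDl; apply: SkD.
rewrite -mulrA -monom_cat_nseq; apply: Sk_term => //; last exact: nondecr_cat_nseq.
move=> s s_tn; case: (List.in_app_or _ _ _ s_tn) => [/tj/D_down//|].
by elim: (n : nat) => //= l IHl [<-|/IHl].
Qed.

Lemma Sk_sub_pol j : subset_of (Sk (seg j)) (pol j).
Proof. by move=> f Sf; apply: ore_pol_const. Qed.

Definition initial_segment D : Prop := forall i j, D j -> lt i j -> D i.

Section InitialSegment.
Variable D : I -> Prop.
Hypothesis D_down : initial_segment D.
Hypothesis D_neq0 : exists j, D j.
Hypothesis seg_subring : forall j, D j -> subring (Sk (seg j)).

Lemma pol_directed : directed D (fun j => pol j).
Proof.
apply: increasing_directed => // i j _ Dj ij f.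
by move=> /(pol_Sk ij (fun s si => lt_trans si ij))/Sk_sub_pol.
Qed.

Lemma pol_subring j : D j -> subring (pol j).
Proof. by move=> Dj; apply/ore_pol_subring/Sk_ore_extension/seg_subring. Qed.

Lemma Sk_pol_union : Sk D = family_union D (fun j => pol j).
Proof.
have pol_union_subring := family_union_subring pol_directed pol_subring.
apply/funext => f; apply/propext; split=> [|[j Dj]]; last first.
  by apply: pol_Sk => // i; apply: D_down.
have R_pol r : R r -> family_union D (fun j => pol j) r.
  by have [j Dj] := D_neq0; exists j => //; apply/Sk_sub_pol/Sk_R.
apply: Sk_min => [|g h|r t Rr _ tD]; [exact: subring0|exact: subringD|].
apply: subringM => //; first exact: R_pol.
rewrite /Defs.monom; elim: t tD => [_|j t IHt tD].
  by rewrite big_nil; apply: subring1.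
rewrite big_cons; apply: subringM => //; last by apply: IHt => s st; apply: tD; right.
have Dj : D j by apply: tD; left.
by exists j => //; apply/ore_polX/Sk_ore_extension/seg_subring.
Qed.

End InitialSegment.

Lemma Sk_subring D : initial_segment D -> subring (Sk D).
Proof.
have step D' : initial_segment D' ->
    (forall j, D' j -> subring (Sk (seg j))) -> subring (Sk D').
  move=> D'_down seg_subring; case: (pselect (exists j, D' j)) => [D'_neq0|D'0].
    rewrite Sk_pol_union //; apply: family_union_subring.
      exact: pol_directed.
    by move=> j D'j; apply: pol_subring D'j.
  suff -> : Sk D' = R by [].
  apply/funext => f; apply/propext; split; last exact: Sk_R.
  by apply: Sk_empty => j D'j; apply: D'0; exists j.
suff segr i : subring (Sk (seg i)) by move=> D_down; apply: step.
elim: i / (lt_wf i) => i _ IHi; apply: step => // j k ki jk; exact: lt_trans jk ki.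
Qed.

Lemma seg_subring i : subring (Sk (seg i)).
Proof. by apply: Sk_subring => j k ki jk; apply: lt_trans jk ki. Qed.

Lemma indep_Sk s : indep_in R R s -> indep (fun=> True) s.
Proof.
move=> [si sR].
have step D : initial_segment D ->
    (forall j, D j -> indep (Sk (seg j)) s) -> indep (Sk D) s.
  move=> D_down seg_indep; case: (pselect (exists j, D j)) => [D_neq0|D0].
    have subrings j (_ : D j) := seg_subring j.
    rewrite Sk_pol_union //; apply: indep_family_union => [|j|j Dj].
    - exact: pol_directed.
    - exact: pol_subring subrings j.
    - apply: (indep_ore_pol (Sk_ore_extension (seg_subring j))).
      split; first exact: seg_indep.
      by move=> v /sR; apply: Sk_R.
  apply: indep_subset si => //; apply: Sk_empty => j Dj; apply: D0; by exists j.
have seg_indep i : indep (Sk (seg i)) s.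
  by elim: i / (lt_wf i) => i _ IHi; apply: step => // j k ki jk; apply: lt_trans jk ki.
have Sk_indep : indep (Sk (fun=> True)) s by apply: step.
by apply: indep_subset Sk_indep => [|f _]; [apply: Sk_subring|case: skew].
Qed.

Definition meets_left_multiples (A : S -> Prop) : Prop :=
  forall c, R c -> c != 0 -> exists2 a, a * c != 0 & A (a * c).

Lemma meets_left_multiples_udim_ge n A :
  udim_ge R n -> meets_left_multiples A -> udim_ge A n.
Proof.
move=> [s <- [si sR]] A_meets.
have True_subring : subring (fun _ : S => True) by [].
have [v v_s|t szt [ti tA]] := indep_refine (P := A) True_subring (indep_Sk (conj si sR)).
  have [a a0 Aa] := A_meets v (sR v v_s) (indep_neq0 si v_s).
  by exists a.
by exists t => //; split=> //; apply: indep_subset ti.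
Qed.

Lemma nicely_essential_meets_left_multiples strong A B :
  subset_of R B -> nicely_essential strong A B -> meets_left_multiples A.
Proof.
move=> RB [_ _ Aess _] c Rc c0; have [|a _ /(_ c)[]] := Aess [:: c].
- by move=> e /[!inE] /eqP->; split=> //; apply: RB.
- by rewrite inE.
- by exists a.
Qed.

Lemma ess_meets_left_multiples strong D A :
  ess R lt x strong D A -> meets_left_multiples A.
Proof.
elim=> {D A} [D A _ Aess|D A Lam F _ _ _ [i Li] _ _ IH A_union|
  D A i At B _ _ _ RAt _ _ _ _ Aess].
- by apply: nicely_essential_meets_left_multiples Aess.
- move=> c Rc c0; have [a a0 Fa] := IH i Li c Rc c0.
  by exists a => //; apply/A_union; exists i.
- exact: nicely_essential_meets_left_multiples Aess.
Qed.

Lemma eq_family_union (Lam : I -> Prop) (F : I -> S -> Prop) (A : S -> Prop) :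
  (forall a, A a <-> exists2 i, Lam i & F i a) -> A = family_union Lam F.
Proof. by move=> A_union; apply/funext => a; apply/propext/A_union. Qed.

Lemma special_ext_nonsing_udim n i T A (B : nat -> S -> Prop) :
  special_subext (Sk (seg i)) (x i) T A B -> udim_ge R n -> subset_of R A ->
  (forall m, Deg (Sk (seg i)) (x i) A m -> nonsing_udim n (B m)) -> nonsing_udim n A.
Proof.
move=> A_special R_ge RA B_ns; have [_ [_ [_ [_ [[d [_ A_Deg]] _]]]]] := A_special.
have ore := Sk_ore_extension (seg_subring i).
apply: (special_nonsing_udim ore A_special A_Deg B_ns).
apply: meets_left_multiples_udim_ge => // c Rc c0.
by exists 1; rewrite mul1r //; apply: RA.
Qed.

Lemma ess_nonsing_udim n strong D A :
  nonsing_udim n R -> ess R lt x strong D A -> nonsing_udim n A.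
Proof.
move=> R_ns Aess; have [_ R_ge _ _] := R_ns.
have ge_n A' D' : ess R lt x strong D' A' -> udim_ge A' n.
  by move=> /ess_meets_left_multiples; apply: meets_left_multiples_udim_ge.
elim: Aess => {D A} [D A D0 Aess|
  D A Lam F D_neq0 D_lim LamD Lam_neq0 F_incr Fess IH A_union|
  D A i At B Di D_i At_special RAt RB0 RB Bess IH Aess].
- have A_ge : udim_ge A n by apply: (ge_n A D); apply: ess_zero.
  exact: nicely_essential_nonsing_udim R_ns A_ge Aess.
- have A_ge : udim_ge A n by apply: (ge_n A D); apply: ess_limit A_union.
  rewrite (eq_family_union A_union) in A_ge *.
  by apply: family_union_nonsing_udim => //; apply: increasing_directed.
- have At_ns := special_ext_nonsing_udim At_special R_ge RAt IH.
  have A_ge : udim_ge A n.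
    by apply: (ge_n A D); apply: ess_succ At_special RAt RB0 RB Bess Aess.
  exact: nicely_essential_nonsing_udim At_ns A_ge Aess.
Qed.

Lemma strong_ess_hereditary n (P : (S -> Prop) -> Prop) D A :
  nonsing_udim n R ->
  (forall A B, nonsing_udim n A -> nonsing_udim n B -> nicely_essential true A B ->
     P B -> P A) ->
  (forall (Lam : I -> Prop) F, directed Lam F -> (forall i, Lam i -> P (F i)) ->
     P (family_union Lam F)) ->
  (forall i D At B d, special_subext (Sk (seg i)) (x i) (Sk D) At B ->
     (forall m, Deg (Sk (seg i)) (x i) At m <-> exists k, m = (d * k)%N) ->
     (forall m, Deg (Sk (seg i)) (x i) At m -> nonsing_udim n (B m)) ->
     (forall m, Deg (Sk (seg i)) (x i) At m -> P (B m)) -> P At) ->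
  P R -> ess R lt x true D A -> P A.
Proof.
move=> R_ns P_ess P_union P_special PR Aess.
have ns D' A' : ess R lt x true D' A' -> nonsing_udim n A' by apply: ess_nonsing_udim.
have [_ R_ge _ _] := R_ns.
elim: Aess => {D A} [D A D0 Aess|
  D A Lam F D_neq0 D_lim LamD Lam_neq0 F_incr Fess IH A_union|
  D A i At B Di D_i At_special RAt RB0 RB Bess IH Aess].
- by apply: P_ess (PR) => //; apply/ns/(ess_zero _ _ D0 Aess).
- rewrite (eq_family_union A_union); apply: P_union => //.
  exact: increasing_directed.
- have B_ns m dm := ns _ _ (Bess m dm).
  have [_ [_ [_ [_ [[d [_ At_Deg]] _]]]]] := At_special.
  apply: P_ess (Aess) _ => //; last exact: P_special At_special At_Deg B_ns IH.
    by apply: (ns D); apply: ess_succ At_special RAt RB0 RB Bess Aess.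
  exact: special_ext_nonsing_udim At_special R_ge RAt B_ns.
Qed.

Lemma strong_ess_prime n D A :
  nonsing_udim n R -> ess R lt x true D A -> prime_ring R -> prime_ring A.
Proof.
move=> R_ns Aess R_prime.
apply: (strong_ess_hereditary R_ns) R_prime Aess =>
  [||i D' At B d At_special At_Deg _ B_prime].
- exact: strongly_essential_prime.
- exact: family_union_prime.
- have ore := Sk_ore_extension (seg_subring i).
  exact: (special_prime ore At_special At_Deg B_prime).
Qed.

Lemma strong_ess_semiprime n D A :
  nonsing_udim n R -> ess R lt x true D A -> semiprime_ring R -> semiprime_ring A.
Proof.
move=> R_ns Aess R_semi.
apply: (strong_ess_hereditary R_ns) R_semi Aess =>
  [||i D' At B d At_special At_Deg B_ns B_semi].
- exact: strongly_essential_semiprime.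
- by move=> Lam F _; apply: family_union_semiprime.
- have ore := Sk_ore_extension (seg_subring i).
  exact: (special_semiprime ore At_special At_Deg B_ns B_semi).
Qed.

End SkewPolynomials.

Theorem mainTheorem18 (S : nzRingType) (R : S -> Prop) (I : Type)
  (lt : I -> I -> Prop) (x : I -> S) (alpha delta : I -> S -> S)
  (A : S -> Prop) :
  skew_poly_bijective R lt x alpha delta ->
  left_goldie R -> prime_ring R \/ semiprime_ring R ->
  ess R lt x false (fun _ => True) A ->
  [/\ left_goldie A,
      (forall n, udim R n -> udim A n) &
      (ess R lt x true (fun _ => True) A ->
         (prime_ring R -> prime_ring A) /\
         (semiprime_ring R -> semiprime_ring A))].
Proof.
move=> skew [[n0 R_n0] R_acc] R_psp Aess.
have R_subring : subring R by case: skew.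
have R_semi : semiprime_ring R by case: R_psp => [/prime_semiprime|].
have R_ns n : udim R n -> nonsing_udim n R.
  by case/(udimP _ R_subring) => ge_n le_n; split=> //; apply: semiprime_nonsingular.
have A_goldie n : udim R n -> left_goldie A /\ udim A n.
  move/R_ns => R_nsn; apply: nonsing_udim_left_goldie.
  exact: (ess_nonsing_udim skew R_nsn Aess).
split; first by case: (A_goldie n0).
  by move=> n /A_goldie[].
move=> A_strong; split.
  exact: (strong_ess_prime skew (R_ns n0 R_n0) A_strong).
exact: (strong_ess_semiprime skew (R_ns n0 R_n0) A_strong).
Qed.
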